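(* Let $\mathsf{K}$ be a simplicial complex which is a triangulation of a $2$-dimensional manifold (possibly with boundary $\partial\mathsf{K}$) and whose vertices are partitioned into $3$ nonempty subsets $V_0,V_1,V_2$. If for every $i=0,1,2$, $$\widetilde H_1(\mathsf{K}_{\{i\}},\ \mathsf{K}_{\{i\}}\cap\partial\mathsf{K})=0,$$ then $\mathsf{K}$ admits a rainbow triangle, i.e. a $2$-simplex of $\mathsf{K}$ with exactly one vertex in each of $V_0,V_1,V_2$.
   Context: Homology $\widetilde H_*$ is reduced simplicial homology with coefficients in an arbitrary (fixed) field; the displayed group is the relative homology group of the pair. A simplicial complex is not distinguished from its topological realization. For $i\in\{0,1,2\}$, $\mathsf{K}_{\{i\}}$ denotes the subcomplex of $\mathsf{K}$ induced by the vertices in $V_i$ (all simplices of $\mathsf{K}$ whose vertices all lie in $V_i$). $\partial\mathsf{K}$ denotes the boundary of the manifold $\mathsf{K}$ (empty if the manifold has no boundary).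
   Formalization: The manifold is taken to be connected and the simplicial complex finite (so compact); otherwise the claim fails, e.g. for three disjoint spheres each of one colour, or for the plane cut into three parallel one-coloured stripes. *)

(* Defs.v *)
From HB Require Import structures.
From mathcomp Require Import all_boot all_order all_algebra.
From mathcomp Require Import boolp classical_sets functions reals topology.
From mathcomp Require Import normedtype.
Import numFieldNormedType.Exports.

Set Implicit Arguments.
Unset Strict Implicit.
Unset Printing Implicit Defensive.

Import Order.TTheory GRing.Theory Num.Theory.

Local Open Scope classical_set_scope.
Local Open Scope ring_scope.

Section SimplicialComplex.
Variable n : nat.
Implicit Types (K : {set {set 'I_n}}) (s t W : {set 'I_n}).

(* Finite abstract simplicial complexes with vertices labelled by elements of
   'I_n (not all labels need be used). The empty face is a simplex of every
   nonempty complex, so the homology below is automatically reduced. *)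
Definition simplicial_complex K : Prop :=
  forall s t, s \in K -> t \subset s -> t \in K.

Definition vertices K : {set 'I_n} := [set v | [set v]%SET \in K]%SET.

Definition induced K W : {set {set 'I_n}} := [set s in K | s \subset W]%SET.

End SimplicialComplex.

Section Homology.
Variables (F : fieldType) (n : nat).
Implicit Types (K A : {set {set 'I_n}}) (s t : {set 'I_n}) (m k : nat).

(* Simplices are oriented by the order of 'I_n; a chain is its family of
   coefficients, indexed by simplices. *)
Definition chain := {ffun {set 'I_n} -> F^o}.

(* The coefficient of i |: t contributes to that of its facet t with sign
   (-1) to the position of i in the ordered simplex i |: t. *)
Definition boundary_fun (c : chain) : chain :=
  [ffun t : {set 'I_n} =>
    \sum_(i | i \notin t) (-1) ^+ #|[set j in t | (j < i)%N]|%SET * c (i |: t)%SET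
    : F^o].

Fact boundary_fun_is_linear : linear boundary_fun.
Proof.
move=> a b c; apply/ffunP => t; rewrite !ffunE scaler_sumr -big_split /=.
by apply: eq_bigr => i _; rewrite !ffunE mulrDr scalerAr.
Qed.

HB.instance Definition _ :=
  GRing.isLinear.Build F chain chain _ boundary_fun boundary_fun_is_linear.

Definition boundary : 'End(chain) := linfun boundary_fun.

(* Indexed by the number m of vertices, i.e. by the dimension plus one. *)
Definition chains K m : {vspace chain} :=
  (<<[seq ([ffun t => (t == s)%:R] : chain) |
       s <- enum [set s in K | #|s| == m]%SET]>>)%VS.

Definition rel_cycles K A k : {vspace chain} :=
  (chains K k.+1 :&: boundary @^-1: chains A k)%VS.

Definition rel_boundaries K A k : {vspace chain} :=
  (boundary @: chains K k.+2 + chains A k.+1)%VS.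

(* Reduced simplicial homology of the pair (K, A) in degree k. The quotient
   of the relative cycles by the relative boundaries is represented by a
   complementary subspace. *)
Definition rel_homology K A k : {vspace chain} :=
  (rel_cycles K A k :\: rel_boundaries K A k)%VS.

End Homology.

Section Surfaces.

Definition homeomorphic (S T : topologicalType) (A : set S) (B : set T) : Prop :=
  exists (f : S -> T) (g : T -> S),
    [/\ set_fun A B f, set_fun B A g, {in A, cancel f g}, {in B, cancel g f}
      & {within A, continuous f} /\ {within B, continuous g}].

Variable R : realType.

Definition half_plane : set 'rV[R]_2 := [set y : 'rV[R]_2 | 0 <= y 0 ord_max].

Variable T : topologicalType.
Implicit Types (X : set T) (p : T).

(* Topological surfaces with (possibly empty) boundary. The Hausdorff and
   second countability axioms are omitted: this is only applied to subspaces
   of Euclidean spaces. *)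
Definition surface X : Prop :=
  forall p, X p -> exists (O : set T) (W : set 'rV[R]_2),
    [/\ open O, O p, open W & homeomorphic (X `&` O) (half_plane `&` W)].

Definition surface_interior X : set T :=
  [set p | X p /\ exists (O : set T) (W : set 'rV[R]_2),
    [/\ open O, O p, open W & homeomorphic (X `&` O) W]].

Definition surface_boundary X : set T := X `\` surface_interior X.

End Surfaces.

Section Realization.
Variables (R : realType) (n : nat).
Implicit Types (K : {set {set 'I_n}}) (s : {set 'I_n}).

(* Barycentric coordinates, with the topology induced by R^n (which is the
   usual topology, since the complexes are finite). *)
Definition realization K : set 'rV[R]_n :=
  [set x : 'rV[R]_n | [/\ forall i, 0 <= x 0 i, \sum_i x 0 i = 1
             & [set i | x 0 i != 0]%SET \in K]].

Definition closed_simplex s : set 'rV[R]_n := realization (powerset s).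

(* The boundary of a triangulated surface, as a subcomplex. *)
Definition boundary_complex K : {set {set 'I_n}} :=
  [set s in K |
    `[< closed_simplex s `<=` surface_boundary R (realization K) >]]%SET.

(* Manifolds are compact (the complexes are finite) and connected; without
   either condition the rainbow triangle theorem fails. *)
Definition triangulated_surface K : Prop :=
  [/\ simplicial_complex K, connected (realization K)
    & surface R (realization K)].

End Realization.

Section Colourings.
Variable n : nat.
Implicit Types (K : {set {set 'I_n}}) (V : 'I_3 -> {set 'I_n}).

Definition vertex_partition K V : Prop :=
  [/\ forall i, V i != finset.set0,
      forall i j, i != j -> (V i :&: V j = finset.set0)%SET
    & (\bigcup_i V i)%SET = vertices K].

Definition rainbow_triangle K V (s : {set 'I_n}) : Prop :=
  [/\ s \in K, #|s| = 3%N & forall i, #|s :&: V i|%SET = 1%N].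

End Colourings.

(* Main.v *)
(* Suppose that no triangle is rainbow, and fix two colours i and j. Each
   triangle coloured by both has exactly two bicoloured edges, so these
   triangles line up in strips running between the i-part and the j-part.
   Orient every strip along itself and let p be the resulting 2-chain: its
   boundary vanishes on the interior bicoloured edges, hence the part w of its
   boundary lying in K_i is a cycle relative to the boundary of the surface. By
   hypothesis w = ds + r with s in K_i and r on the boundary, and the 2-chain
   p - s has zero boundary on each interior edge that meets V_i. Since vertex
   links are connected, its coefficients are all zero or all nonzero around a
   vertex of colour i, and so along a component of K_i; they are nonzero on the
   triangles of colours i, j and zero on those meeting the third colour. So a
   component of K_i sees only one other colour. The colour missing around a
   vertex is then constant along edges, hence on K, although no vertex misses
   its own colour.

   The facts used about triangulated surfaces come from two principles. A small
   punctured half disc is connected, so no point is a local cut point: links are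
   connected and each edge lies in a triangle. Invariance of domain in the plane,
   deduced from the Borsuk-Ulam theorem for the disc, bounds the number of
   triangles at an edge by two and detects the boundary. *)
Require Import Defs.
From mathcomp Require Import all_boot all_order all_algebra.
From mathcomp Require Import zify ring lra.
From mathcomp Require Import boolp classical_sets functions reals topology.
From mathcomp Require Import interval_inference normedtype.
Import numFieldNormedType.Exports.

Set Implicit Arguments.
Unset Strict Implicit.
Unset Printing Implicit Defensive.

Import Order.TTheory GRing.Theory Num.Theory.

Local Open Scope classical_set_scope.
Local Open Scope ring_scope.

(** * Borsuk-Ulam and invariance of domain in the plane *)

Section GridBorsukUlam.
Implicit Types l m : bool * bool.

(* A label (axis, sign) stands for one of the four directions of the plane,
   numbered counterclockwise by [quadrant]; [turn] is the number of quarter turns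
   between two labels, with the junk value 0 for opposite ones. *)
Definition opposite l : bool * bool := (l.1, ~~ l.2).

Definition quadrant l : int :=
  match l with
  | (false, true) => 0 | (true, true) => 1
  | (false, false) => 2 | (true, false) => 3
  end.

Definition turn l m : int :=
  if l.1 == m.1 then 0 else (-1) ^+ (l.1 (+) (l.2 != m.2)).

Lemma turnC l m : turn l m = - turn m l.
Proof. by case: l m => [[] []] [[] []]. Qed.

Lemma turn_opposite l m : turn (opposite l) (opposite m) = turn l m.
Proof. by case: l m => [[] []] [[] []]. Qed.

(** Away from opposite labels, where [turn] holds junk, this makes turns along a path telescope
    modulo full revolutions. *)
Lemma turn_quadrant l m : m != opposite l ->
  exists k : int, turn l m = quadrant m - quadrant l + 4 * k.
Proof.
by case: l m => [[] []] [[] []]//= _;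
  first [by exists 0|by exists 1|by exists (-1)].
Qed.

Lemma turn_sum (l : nat -> bool * bool) M :
  (forall i, (i < M)%N -> l i.+1 != opposite (l i)) ->
  exists k : int, \sum_(0 <= i < M) turn (l i) (l i.+1)
    = quadrant (l M) - quadrant (l 0%N) + 4 * k.
Proof.
elim: M => [|M IH] lP; first by exists 0; rewrite big_nil subrr.
have [i iM|k sk] := IH; first exact/lP/ltnW.
have [k' sk'] := turn_quadrant (lP _ (ltnSn M)).
by exists (k + k'); rewrite big_nat_recr//= sk sk'; lia.
Qed.

(** Labels no two of which are opposite use at most one sign on each axis, so they take at most two
    perpendicular directions, among which a closed path cannot wind. *)
Lemma turn_cell (a b c d : bool * bool) :
  [&& b != opposite a, c != opposite a, d != opposite a,
      c != opposite b, d != opposite b & d != opposite c] ->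
  turn a b - turn c d + (turn b d - turn a c) = 0.
Proof. by case: a b c d => [[] []] [[] []] [[] []] [[] []]. Qed.

(* The turning along the boundary of the grid is the sum of those along its
   cells, hence 0; by antipodality it is also twice the turning along half of the
   boundary, which is 2 modulo 4. *)
Lemma grid_borsuk_ulam (M : nat) (l : nat -> nat -> bool * bool) :
  (forall i i' j j', (i <= i' <= i.+1)%N -> (j <= j' <= j.+1)%N ->
     (i' <= M)%N -> (j' <= M)%N -> l i' j' != opposite (l i j)) ->
  (forall i j, (i < M)%N -> (j < M)%N -> l i j.+1 != opposite (l i.+1 j)) ->
  (forall i, (i <= M)%N -> l (M - i)%N M = opposite (l i 0%N)) ->
  (forall j, (j <= M)%N -> l 0%N (M - j)%N = opposite (l M j)) -> False.
Proof.
move=> lP lQ lh lv.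
pose H i j := turn (l i j) (l i.+1 j); pose V i j := turn (l i j) (l i j.+1).
have cell i j : (i < M)%N -> (j < M)%N ->
    H i j - H i j.+1 + (V i.+1 j - V i j) = 0.
  move=> iM jM; apply: turn_cell; rewrite lQ//=.
  by apply/and5P; split; rewrite lP//; lia.
have : \sum_(0 <= i < M) \sum_(0 <= j < M)
    (H i j - H i j.+1 + (V i.+1 j - V i j)) = 0.
  by apply: big1_seq => i; rewrite mem_index_iota => /andP[_ iM];
    apply: big1_seq => j; rewrite mem_index_iota => /andP[_ jM]; exact: cell.
under eq_bigr do rewrite big_split/=.
rewrite big_split/= [X in _ + X]exchange_big/=.
under [X in X + _]eq_bigr => i _.
  under eq_bigr do rewrite -opprB.
  rewrite sumrN telescope_sumr//.
  over.
under [X in _ + X]eq_bigr do rewrite telescope_sumr//.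
rewrite sumrN !sumrB.
have -> : \sum_(0 <= i < M) H i M = - \sum_(0 <= i < M) H i 0%N.
  rewrite -sumrN big_nat_rev/=; apply: eq_big_nat => i iM.
  rewrite /H [in RHS]turnC opprK -[in RHS]turn_opposite -!lh; [|lia|lia].
  by rewrite add0n subnSK; lia.
have -> : \sum_(0 <= i < M) V 0%N i = - \sum_(0 <= i < M) V M i.
  rewrite -sumrN big_nat_rev/=; apply: eq_big_nat => i iM.
  rewrite /V [in RHS]turnC opprK -[in RHS]turn_opposite -!lv; [|lia|lia].
  by rewrite add0n subnSK; lia.
have [|a ->] := @turn_sum (l^~ 0%N) M.
  by move=> i iM; rewrite lP//=; lia.
have [|b ->] := @turn_sum (l M) M.
  by move=> i iM; rewrite lP//=; lia.
have := lv _ (leqnn M); rewrite subnn => lM.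
by have := lh _ (leq0n M); rewrite subn0 => ->; case: (l 0%N 0%N) => [[] []]/=; lia.
Qed.

End GridBorsukUlam.

(** * The plane with the supremum norm *)

Section Plane.
Variable R : realType.

Lemma coord_le_norm n (x : 'rV[R]_n) i : `|x 0 i| <= `|x|.
Proof.
rewrite [leRHS]/Num.Def.normr/= mx_normrE; apply/bigmax_geP; right => /=.
by exists (ord0, i).
Qed.

Lemma norm_le_coord n (x : 'rV[R]_n) e : 0 <= e ->
  (forall i, `|x 0 i| <= e) -> `|x| <= e.
Proof.
move=> e0 xe; rewrite [leLHS]/Num.Def.normr/= mx_normrE; apply/bigmax_leP.
by split=> // -[i j] _ /=; rewrite (ord1 i).
Qed.

Definition pt (a b : R) : 'rV[R]_2 := \row_i (if i == 0 then a else b).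

Lemma pt0 a b : pt a b 0 0 = a. Proof. by rewrite mxE. Qed.
Lemma pt1 a b : pt a b 0 ord_max = b. Proof. by rewrite mxE. Qed.

Lemma pt_eta (x : 'rV[R]_2) : x = pt (x 0 0) (x 0 ord_max).
Proof.
apply/rowP => i; rewrite mxE; have [->//|i0] := eqVneq i 0.
by congr (x 0 _); apply/val_inj; case: i i0 => [[|[|]]].
Qed.

Lemma norm_pt a b : `|pt a b| = Num.max `|a| `|b|.
Proof.
apply/eqP; rewrite eq_le ge_max; apply/andP; split.
  apply: norm_le_coord => [|i]; first by rewrite le_max normr_ge0.
  by rewrite mxE le_max; case: ifP; rewrite lexx ?orbT.
by have := coord_le_norm (pt a b); move=> h;
  rewrite -{1}(pt0 a b) h -{1}(pt1 a b) h.
Qed.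

Lemma pt_sub a b c d : pt a b - pt c d = pt (a - c) (b - d).
Proof. by apply/rowP => i; rewrite !mxE; case: ifP. Qed.

Lemma pt_opp a b : - pt a b = pt (- a) (- b).
Proof. by apply/rowP => i; rewrite !mxE; case: ifP. Qed.

(** The half axis closest in direction to [v]. Ties go to the first axis, and the junk value at 0 is
    [(false, false)]. *)
Definition sector (v : 'rV[R]_2) : bool * bool :=
  if `|v 0 ord_max| <= `|v 0 0| then (false, 0 < v 0 0)
  else (true, 0 < v 0 ord_max).

Lemma sector_opp (v : 'rV[R]_2) : v != 0 -> sector (- v) = opposite (sector v).
Proof.
rewrite (pt_eta v); set a := v 0 0; set b := v 0 ord_max => ab.
rewrite /sector pt_opp !pt0 !pt1 !normrN /opposite; case: ifP => ba /=.
  rewrite oppr_gt0 -leNgt lt_neqAle; congr pair; apply/andb_idl => _.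
  apply: contra ab => /eqP a0; move: ba; rewrite a0 normr0 normr_le0 => /eqP ->.
  by apply/eqP/rowP => i; rewrite !mxE if_same.
rewrite oppr_gt0 -leNgt lt_neqAle; congr pair; apply/andb_idl => _.
by apply: contraFN ba => /eqP ->; rewrite normr0 normr_ge0.
Qed.

(** Both vectors attain their supremum norm on the same axis, with opposite signs (zero counting as
    negative), and the distance along that axis is already the sum of the norms. *)
Lemma sector_opposite_dist (v w : 'rV[R]_2) : sector w = opposite (sector v) ->
  `|w| + `|v| <= `|w - v|.
Proof.
rewrite (pt_eta v) (pt_eta w) pt_sub !norm_pt /sector /opposite !pt0 !pt1.
move: (v 0 0) (v 0 ord_max) (w 0 0) (w 0 ord_max) => a b c d.
rewrite le_max; case: (leP `|b|) => ba; case: (leP `|d|) => dc //= -[] h;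
  apply/orP; [left|right]; move: h;
  case: ltP => // h1; case: ltP => // h2 _.
- rewrite (gtr0_norm h1) (ler0_norm h2) ger0_norm; lra.
- rewrite (gtr0_norm h2) (ler0_norm h1) ler0_norm; lra.
- rewrite (gtr0_norm h1) (ler0_norm h2) ger0_norm; lra.
- rewrite (gtr0_norm h2) (ler0_norm h1) ler0_norm; lra.
Qed.

Lemma compact_square r : compact [set x : 'rV[R]_2 | `|x| <= r].
Proof.
apply: bounded_closed_compact.
  exists r; split; first exact: num_real.
  by move=> s rs x /= xr; rewrite (le_trans xr)// ltW.
have -> : [set x : 'rV[R]_2 | `|x| <= r] = closed_ball_ Num.Def.normr 0 r.
  by apply/seteqP; split=> x /=; rewrite /closed_ball_ /= sub0r normrN.
exact: closed_closed_ball_.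
Qed.

(** By [sector_opposite_dist], this bound keeps nearby points from having opposite sectors. It holds
    near each point because [u] does not vanish, and compactness makes the mesh uniform. *)
Lemma uniform_oscillation (u : 'rV[R]_2 -> 'rV[R]_2) r e :
  continuous u -> (forall x, u x != 0) ->  0 < e ->
  exists N : nat, forall x y, `|x| <= r -> `|y - x| <= e / N.+1%:R ->
    `|u y - u x| < `|u y| + `|u x|.
Proof.
move=> cu u0 e0; have /compact_near_coveringP := compact_square (r:=r).
move=> /(_ nat \oo (fun N x => forall y, `|y - x| <= e / N.+1%:R ->
    `|u y - u x| < `|u y| + `|u x|)).
have near_x (x : 'rV[R]_2) : `|x| <= r -> \forall x' \near x & N \near \oo,
    forall y, `|y - x'| <= e / N.+1%:R -> `|u y - u x'| < `|u y| + `|u x'|.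
  (* Two values within a third of [|u x|] of [u x] differ by less than two thirds of [|u x|],
     whereas [|u y|] exceeds two thirds of it. *)
  move=> xr; have ux0 : 0 < `|u x| / 3 by rewrite divr_gt0// normr_gt0.
  have /cvgrPdist_lt/(_ _ ux0)/nbhs_ballP[d /= d0 ud] := cu x.
  have d20 : 0 < d / 2 by rewrite divr_gt0.
  exists (ball x (d / 2), [set N | e / N.+1%:R < d / 2]).
    split; first exact: nbhsx_ballx.
    have h0 : 0 < d / 2 / e by rewrite divr_gt0.
    have := near_infty_natSinv_lt (PosNum h0); apply: filterS => N /=.
    by rewrite ltr_pdivlMr// mulrC.
  move=> [x' N] [/= xx' Nd] y yx'.
  have ball_u z : `|x - z| < d -> `|u x - u z| < `|u x| / 3.
    by move=> xz; apply: ud; rewrite -ball_normE.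
  move: xx'; rewrite -ball_normE/= => xx'.
  have h1 : `|u x - u x'| < `|u x| / 3 by apply: ball_u; lra.
  have h2 : `|u x - u y| < `|u x| / 3.
    apply: ball_u; have := ler_normD (x - x') (x' - y); rewrite addrA subrK.
    move: Nd yx' => /= Nd yx'; have := le_lt_trans yx' Nd.
    by rewrite [`|x' - y|]distrC => ?; lra.
  have h3 := lerB_dist (u x) (u y).
  have := ler_normD (u y - u x) (u x - u x'); rewrite addrA subrK.
  have h4 := normr_ge0 (u x'); rewrite [`|u y - u x|]distrC; lra.
move=> h; have {h}[N _ hN] := h _ near_x.
by exists N => x y xr yx; exact: (hN N (leqnn N)).
Qed.

(** Through [sector], a nowhere vanishing [u] would label a fine grid on the square of radius 3 in a
    way excluded by [grid_borsuk_ulam]. The radius 3 is where [odd_extension] is odd. *)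
Lemma plane_borsuk_ulam (u : 'rV[R]_2 -> 'rV[R]_2) : continuous u ->
  (forall x, `|x| = 3 -> u (- x) = - u x) -> exists x, u x = 0.
Proof.
move=> cu uN; apply: contrapT => u0.
have {}u0 x : u x != 0 by apply/eqP => ux; apply: u0; exists x.
have [//|N uP] := uniform_oscillation 3 (e := 6) cu u0.
pose M := N.+1; pose c i : R := -3 + 6 * (i%:R / M%:R).
have M0 : 0 < M%:R :> R by rewrite ltr0n.
have c_le i : (i <= M)%N -> `|c i| <= 3.
  move=> iM; have : 0 <= i%:R / M%:R :> R by rewrite divr_ge0.
  have : i%:R / M%:R <= 1 :> R by rewrite ler_pdivrMr// mul1r ler_nat.
  by rewrite /c ler_norml => ? ?; apply/andP; split; lra.
have c0 : c 0%N = -3 by rewrite /c mul0r mulr0 addr0.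
have cM : c M = 3 by rewrite /c divff ?gt_eqF//; lra.
have cB i : (i <= M)%N -> c (M - i)%N = - c i.
  move=> iM; rewrite /c natrB// mulrBl divff ?gt_eqF//.
  by set z : R := _ / _; lra.
have c_step i j : (i <= j <= i.+1)%N -> `|c j - c i| <= 6 / M%:R.
  case/andP => ij ji; have -> : c j - c i = 6 / M%:R * (j - i)%:R.
    by rewrite natrB// /c; move: (gt_eqF M0); set m := M%:R => /negbT ?; field.
  have q0 : 0 <= 6 / M%:R :> R by rewrite divr_ge0.
  by rewrite normrM (ger0_norm q0) normr_nat ler_piMr// lern1; lia.
pose l i j := sector (u (pt (c i) (c j))).
have pt_le i j : (i <= M)%N -> (j <= M)%N -> `|pt (c i) (c j)| <= 3.
  by move=> iM jM; rewrite norm_pt ge_max !c_le.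
have opp_far x y : `|x| <= 3 -> `|y - x| <= 6 / M%:R ->
    sector (u y) != opposite (sector (u x)).
  move=> x3 yx; apply/eqP => /sector_opposite_dist.
  by rewrite leNgt uP.
have antipode i j i' j' : (i <= M)%N -> (j <= M)%N ->
    `|pt (c i) (c j)| = 3 -> c i' = - c i -> c j' = - c j ->
    l i' j' = opposite (l i j).
  by move=> iM jM p3 ii jj; rewrite /l ii jj -pt_opp uN// sector_opp.
apply: (@grid_borsuk_ulam M l) => [i i' j j' ii jj iM jM|i j iM jM|i iM|j jM].
- apply: opp_far; first by apply: pt_le; lia.
  by rewrite pt_sub norm_pt ge_max !c_step.
- apply: opp_far; first by apply: pt_le; lia.
  by rewrite pt_sub norm_pt ge_max distrC !c_step// leqnn leqnSn.
- apply: antipode => //; last by rewrite cM c0 opprK.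
    by rewrite norm_pt c0 normrN (ger0_norm (ler0n _ 3)) max_r// c_le.
  exact: cB.
- apply: antipode => //; last exact: cB.
    by rewrite norm_pt cM (ger0_norm (ler0n _ 3)) max_l// c_le.
  by rewrite cM c0.
Qed.

Lemma continuous_comp_within (S T U : topologicalType) (A : set T)
    (p : S -> T) (f : T -> U) x : {within A, continuous f} ->
  {for x, continuous p} -> (forall y, A (p y)) -> {for x, continuous (f \o p)}.
Proof.
move=> /subspace_continuousP cf cp Ap B /(cf _ (Ap x)) fB.
have h : nbhs x (p @^-1` [set y | A y -> B (f y)]) := cp _ fB.
by apply: (@filterS _ _ (nbhs_filter x) _ _ _ h) => y /(_ (Ap y)).
Qed.

(** * Invariance of domain *)

Definition clamp (y : R) := Num.min 1 (Num.max 0 y).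

Lemma clamp_itv y : 0 <= clamp y <= 1.
Proof. by rewrite /clamp le_min ge_min le_max ler01 !lexx. Qed.

Lemma clamp_le0 y : y <= 0 -> clamp y = 0.
Proof. by move=> y0; rewrite /clamp max_l ?min_r. Qed.

Lemma clamp_ge1 y : 1 <= y -> clamp y = 1.
Proof. by move=> y1; rewrite /clamp max_r ?min_l// (le_trans ler01). Qed.

Lemma cvg_clamp (T : topologicalType) (g : T -> R) x : {for x, continuous g} ->
  clamp (g y) @[y --> x] --> clamp (g x).
Proof.
move=> cg; exact: (@continuous_min R T (fun=> 1) ((fun=> 0) \max g) x
  (cvg_cst _) (@continuous_max R T (fun=> 0) g x (cvg_cst _) cg)).
Qed.

(* Deforms the boundary values [f x - c] of the unit square into the odd map
   [f (x / 2) - f (- x / 2)] of the square of radius 3, through [f x - f 0];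
   the injectivity of f keeps the last stage away from 0. *)
Definition odd_extension (f : 'rV[R]_2 -> 'rV[R]_2) c x :=
  let t := clamp (`|x| - 2) in
  let p := ((1 + t) * Num.max 1 `|x|)^-1 *: x in
  f p - f (- t *: p) + (1 - clamp (`|x| - 1)) *: (f 0 - c).

(** [f] is only assumed continuous within the unit square, so the point is that both of its
    arguments stay there. *)
Lemma odd_extension_continuous (T : topologicalType) (i : T -> 'rV[R]_2) f c :
  continuous i -> {within [set x | `|x| <= 1], continuous f} ->
  continuous (odd_extension f c \o i).
Proof.
move=> ci cf; rewrite /odd_extension /=.
pose t (x : T) := clamp (`|i x| - 2).
pose p (x : T) := ((1 + t x) * Num.max 1 `|i x|)^-1 *: i x.
have t01 x : 0 <= t x <= 1 by exact: clamp_itv.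
have den0 x : 0 < (1 + t x) * Num.max 1 `|i x|.
  by rewrite mulr_gt0 ?lt_max ?ltr01// ltr_pwDl//; case/andP: (t01 x).
have p1 x : `|p x| <= 1.
  rewrite normrZ normfV (gtr0_norm (den0 x)) ler_pdivrMl// mulr1.
  rewrite (le_trans (y := Num.max 1 `|i x|)) ?le_max ?lexx ?orbT//.
  rewrite ler_peMl ?le_max ?ler01// lerDl; by case/andP: (t01 x).
have tp1 x : `|- t x *: p x| <= 1.
  rewrite normrZ normrN; case/andP: (t01 x) => t0 t1.
  by rewrite ger0_norm// mulr_ile1.
have cn : continuous (fun x => `|i x|) by move=> x; exact: cvg_norm (ci x).
have ct : continuous t.
  by move=> x; apply: cvg_clamp; apply: cvgB; [exact: cn|exact: cvg_cst].
have cp : continuous p.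
  move=> x; apply: cvgZ; last exact: ci.
  apply: cvgV; first by rewrite gt_eqF.
  apply: cvgM; first by apply: cvgD; [exact: cvg_cst|exact: ct].
  exact: (@continuous_max R T (fun=> 1) (fun x => `|i x|) x (cvg_cst _) (cn x)).
move=> x; apply: cvgD.
  apply: cvgB; first exact: (continuous_comp_within cf (cp x) p1).
  apply: (continuous_comp_within cf _ tp1).
  apply: cvgZ; [apply: cvgN; exact: ct|exact: cp].
apply: cvgZ; last exact: cvg_cst.
apply: cvgB; first exact: cvg_cst.
by apply: cvg_clamp; apply: cvgB; [exact: cn|exact: cvg_cst].
Qed.

(* If the value c, close to f 0, were not attained, then [odd_extension f c]
   would contradict the Borsuk-Ulam theorem. *)
Lemma invariance_of_domain_unit (f : 'rV[R]_2 -> 'rV[R]_2) :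
  {within [set x | `|x| <= 1], continuous f} ->
  (forall x y, `|x| <= 1 -> `|y| <= 1 -> f x = f y -> x = y) ->
  nbhs (f 0) (f @` [set x | `|x| <= 1]).
Proof.
move=> cf fI.
(* By injectivity [f 0] is off the compact image of the boundary of the square; all values closer to
   [f 0] than [d] will be attained. *)
have [d d0 fd] : exists2 d : R, 0 < d & forall x, `|x| = 1 -> d <= `|f 0 - f x|.
  have cS : compact [set x : 'rV[R]_2 | `|x| = 1].
    apply: bounded_closed_compact.
      exists 1; split; first exact: num_real.
      by move=> s rs x /= ->; rewrite ltW.
    have /continuous_closedP := @norm_continuous R 'rV[R]_2.
    by move=> /(_ _ (closed_eq (y := 1))).
  have /compact_closed : compact (f @` [set x | `|x| = 1]).
    apply: continuous_compact cS; apply: continuous_subspaceW cf => x /= ->.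
    exact: lexx.
  move=> /(_ (@norm_hausdorff _ _))/closed_openC.
  rewrite openE => /(_ (f 0)) f0; have /f0/nbhs_ballP[d /= d0 fd] :
      (~` (f @` [set x | `|x| = 1])) (f 0).
    move=> [x /= x1 fx]; have : x = 0 by apply: fI fx; rewrite ?x1// normr0 ler01.
    by move=> x0; move: x1; rewrite x0 normr0 => /eqP; rewrite eq_sym oner_eq0.
  exists d => // x x1; rewrite leNgt; apply/negP => xd.
  by apply: (fd (f x)); [rewrite -ball_normE|exists x].
apply/nbhs_ballP; exists d => // c; rewrite -ball_normE /= => f0c.
apply: contrapT => fc.
have {}fc x : `|x| <= 1 -> f x != c.
  by move=> x1; apply/eqP => fx; apply: fc; exists x.
have cu := @odd_extension_continuous _ id f c (fun x => @cvg_id _ (nbhs x)) cf.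
have [x|x] := plane_borsuk_ulam cu.
  move=> x3; rewrite /odd_extension /= normrN x3.
  have -> : clamp (3 - 2) = 1 by rewrite clamp_ge1//; lra.
  have -> : clamp (3 - 1) = 1 by rewrite clamp_ge1//; lra.
  by rewrite subrr scale0r !addr0 !scaleN1r scalerN opprK opprB.
rewrite /odd_extension /=.
have [x1|x1] := lerP `|x| 1.
  rewrite !clamp_le0; [|lra|lra].
  rewrite !oppr0 scale0r !addr0 scale1r mul1r addrA subrK.
  by rewrite invr1 scale1r => /eqP; rewrite subr_eq0 (negbTE (fc x x1)).
(* On this annulus [p] has norm 1, and the value is [f p - f 0] plus a multiple of [f 0 - c] of norm
   below [d], too short to cancel it. *)
have [x2|x2] := leP `|x| 2.
  rewrite (@clamp_le0 (`|x| - 2)); last lra.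
  rewrite oppr0 scale0r addr0 mul1r; set p := _ *: x => /eqP.
  have px : `|p| = 1.
    by rewrite normrZ normfV normr_id mulVf// gt_eqF// (lt_trans _ x1).
  rewrite addr_eq0 => /eqP fp.
  have := fd _ px; rewrite distrC fp normrN normrZ leNgt; case/negP.
  apply: le_lt_trans f0c; case/andP: (clamp_itv (`|x| - 1)) => s0 s1.
  by rewrite ler_piMl// ger0_norm; lra.
(* A zero now gives [f p = f (- t *: p)], hence [(1 + t) *: p = 0] by injectivity, although [x] is
   nonzero. *)
rewrite (@clamp_ge1 (`|x| - 1)); last lra.
rewrite subrr scale0r addr0; case/andP: (clamp_itv (`|x| - 2)).
set t := clamp _; set p := _ *: x => t0 t1 /eqP; rewrite subr_eq0 => /eqP fp.
have x0 : 0 < `|x| by rewrite (lt_trans _ x1).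
have p1 : `|p| <= 1.
  rewrite normrZ normfV normrM normr_id invfM mulfVK ?gt_eqF//.
  rewrite invf_le1 ?normr_gt0 ?ger0_norm; lra.
have tp1 : `|- t *: p| <= 1.
  by rewrite normrZ normrN ger0_norm// mulr_ile1.
have /eqP := fI _ _ p1 tp1 fp.
rewrite -subr_eq0 -[X in X - _]scale1r -scalerBl opprK !scaler_eq0 invr_eq0.
rewrite mulf_eq0 normr_eq0 -(normr_eq0 x) (gt_eqF x0) !orbF orbb.
by rewrite gt_eqF// ltr_pwDl.
Qed.

Lemma within_continuous_comp (S T U : topologicalType) (A : set T) (B : set S)
    (p : S -> T) (f : T -> U) :
  {within A, continuous f} -> {within B, continuous p} ->
  (forall y, B y -> A (p y)) -> {within B, continuous (f \o p)}.
Proof.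
move=> /subspace_continuousP cf /subspace_continuousP cp BA.
apply/subspace_continuousP => x Bx.
have Ax := BA x Bx => C /(cf _ Ax) fC.
have h : nbhs x [set y | B y -> A (p y) -> C (f (p y))] := cp x Bx _ fC.
by apply: (@filterS _ _ (nbhs_filter x) _ _ _ h) => y Cy By; exact: Cy By (BA y By).
Qed.

Lemma affine_continuous (V : normedModType R) (q : V) (k : R) :
  continuous (fun x : V => q + k *: x).
Proof.
by move=> x; apply: cvgD; [exact: cvg_cst|apply: cvgZ; [exact: cvg_cst|exact: cvg_id]].
Qed.

(** An affine rescaling turns a closed square around [q] inside [A] into the unit square; halving
    the radius of an open ball makes room for it. *)
Lemma invariance_of_domain (A : set 'rV[R]_2) (f : 'rV[R]_2 -> 'rV[R]_2) q :
  nbhs q A -> {within A, continuous f} ->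
  (forall x y, A x -> A y -> f x = f y -> x = y) -> nbhs (f q) (f @` A).
Proof.
move=> /nbhs_ballP[d /= d0 dA] cf fI.
pose a (x : 'rV[R]_2) := q + (d / 2) *: x.
have aA x : `|x| <= 1 -> A (a x).
  move=> x1; apply: dA; rewrite -ball_normE /= /a opprD addNKr normrN normrZ.
  by rewrite gtr0_norm ?divr_gt0//; nra.
have := @invariance_of_domain_unit (f \o a); rewrite /= (_ : a 0 = q);
  last by rewrite /a scaler0 addr0.
move=> H; apply: filterS (H _ _) => [y [x /= x1 <-]||x y x1 y1 /fI].
- by exists (a x) => //; exact: aA.
- apply: within_continuous_comp cf _ aA.
  by apply: continuous_subspaceT; exact: affine_continuous.
- move=> /(_ (aA _ x1) (aA _ y1)) /addrI /scalerI; apply.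
  by rewrite mulf_neq0// ?invr_eq0 gt_eqF.
Qed.

(** * Punctured half squares and local cut points *)

Lemma convex_connected (A : set 'rV[R]_2) :
  (forall x y t, A x -> A y -> 0 <= t <= 1 -> A (x + t *: (y - x))) ->
  connected A.
Proof.
move=> cA; have [->|/set0P[x0 Ax0]] := eqVneq A set0; first exact: connected0.
have -> : A = \bigcup_(y in A) ((fun t : R => x0 + t *: (y - x0)) @` `[0, 1]).
  apply/seteqP; split=> [y Ay|_ [y Ay [t t01 <-]]].
    exists y => //; exists 1; rewrite ?scale1r ?subrKC//.
    by rewrite /= in_itv/= ler01 lexx.
  by apply: cA => //; move: t01; rewrite /= in_itv.
apply: bigcup_connected.
  exists x0 => y _; exists 0; rewrite ?scale0r ?addr0//.
  by rewrite /= in_itv/= lexx ler01.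
move=> y _; apply: connected_continuous_connected; first exact: segment_connected.
apply: continuous_subspaceT => t.
by apply: cvgD; [exact: cvg_cst|apply: cvgZ; [exact: cvg_id|exact: cvg_cst]].
Qed.

(** The set is the union of its convex parts strictly above, right of, left of and below [q]. The
    half plane is unbounded upwards, so [up] meets [right] and [left]; [down] is empty when [q] is
    on the edge of the half plane, and otherwise meets [right]. *)
Lemma punctured_half_square_connected (q : 'rV[R]_2) e : 0 < e ->
  half_plane q -> connected [set y | [/\ half_plane y, `|q - y| < e & y != q]].
Proof.
move=> e0; rewrite /half_plane /= => q1.
set C := [set y : 'rV[R]_2 | _].
pose B := [set y : 'rV[R]_2 | 0 <= y 0 ord_max /\ `|q - y| < e].
have BP x y : B (pt x y) <-> [/\ 0 <= y, `|q 0 0 - x| < e & `|q 0 ord_max - y| < e].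
  rewrite /B /= pt1 {1}(pt_eta q) pt_sub norm_pt gt_max.
  by split=> [[-> /andP[]]|[-> -> ->]].
pose side (h : 'rV[R]_2 -> R) := [set y | B y /\ 0 < h y].
have side_connected h :
    (forall x y t, h (x + t *: (y - x)) = h x + t * (h y - h x)) ->
    connected (side h).
  move=> hl; apply: convex_connected => x y t [[x1 xe] hx] [[y1 ye] hy] /andP[t0 t1].
  have t10 : 0 <= 1 - t by rewrite subr_ge0.
  have side_pos (a b : R) : 0 < a -> 0 < b -> 0 < a + t * (b - a).
    move=> a0 b0; have -> : a + t * (b - a) = (1 - t) * a + t * b by ring.
    have [->|tn0] := eqVneq t 0; first by rewrite subr0 mul1r mul0r addr0.
    apply: ltr_wpDl; first by rewrite mulr_ge0// ltW.
    by rewrite mulr_gt0// lt_neqAle eq_sym tn0.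
  split; first split; last by rewrite hl; exact: side_pos.
    by rewrite !mxE; have := mulr_ge0 t10 x1; have := mulr_ge0 t0 y1; lra.
  have -> : q - (x + t *: (y - x)) = (1 - t) *: (q - x) + t *: (q - y).
    by apply/rowP => i; rewrite !mxE; ring.
  apply: le_lt_trans (ler_normD _ _) _; rewrite !normrZ (ger0_norm t0).
  rewrite (ger0_norm t10) -subr_gt0.
  have := side_pos (e - `|q - x|) (e - `|q - y|); rewrite !subr_gt0.
  by move=> /(_ xe ye); lra.
pose up := side (fun y => y 0 ord_max - q 0 ord_max).
pose down := side (fun y => q 0 ord_max - y 0 ord_max).
pose right := side (fun y => y 0 0 - q 0 0).
pose left := side (fun y => q 0 0 - y 0 0).
have upP : connected up by apply: side_connected => x y t; rewrite !mxE; ring.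
have downP : connected down by apply: side_connected => x y t; rewrite !mxE; ring.
have rightP : connected right by apply: side_connected => x y t; rewrite !mxE; ring.
have leftP : connected left by apply: side_connected => x y t; rewrite !mxE; ring.
have e20 : 0 < e / 2 by rewrite divr_gt0.
have Ce : C = up `|` right `|` left `|` down.
  apply/seteqP; split=> y; last first.
    by move=> [[[]|]|] [[y1 ye] hy]; split=> //; apply/eqP => yq;
      move: hy; rewrite yq subrr ltxx.
  move=> [y1 ye yq]; have By : B y by [].
  case: (ltrgtP (y 0 0) (q 0 0)) => y0.
  - by left; right; split; rewrite ?subr_gt0.
  - by left; left; right; split; rewrite ?subr_gt0.
  case: (ltrgtP (y 0 ord_max) (q 0 ord_max)) => y01.
  - by right; split; rewrite ?subr_gt0.
  - by left; left; left; split; rewrite ?subr_gt0.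
  by move: yq; rewrite (pt_eta y) (pt_eta q) y0 y01 eqxx.
have dist_e (z : R) : `|z - (z + e / 2)| < e.
  by rewrite opprD addNKr normrN gtr0_norm//; lra.
have dist_e' (z : R) : `|z - (z - e / 2)| < e.
  by rewrite subKr gtr0_norm//; lra.
have qe : 0 <= q 0 ord_max + e / 2 by lra.
have url : connected (up `|` right `|` left).
  apply: connectedU => //; last first.
    apply: connectedU => //.
    exists (pt (q 0 0 + e / 2) (q 0 ord_max + e / 2)).
    by split; split; rewrite ?BP// ?pt0 ?pt1; lra.
  exists (pt (q 0 0 - e / 2) (q 0 ord_max + e / 2)).
  by split; [left|]; split; rewrite ?BP// ?pt0 ?pt1; lra.
rewrite Ce; have [->|/set0P[y [yB yd]]] := eqVneq down set0; first by rewrite setU0.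
apply: connectedU => //.
move: yB; rewrite (pt_eta y) BP => -[y1 _ y1e].
exists (pt (q 0 0 + e / 2) (y 0 ord_max)).
by split; [left; right|]; split; rewrite ?BP// ?pt0 ?pt1//; lra.
Qed.

(** The inverse chart maps a small punctured half square to a connected set around [p]. It meets
    both [U1] and [U2], as these accumulate at [p], so they would separate it. *)
Lemma surface_not_cut (T : topologicalType) (X : set T) p (O U1 U2 : set T) :
  surface R X -> X p -> open O -> O p ->
  open U1 -> open U2 ->
  (forall x, X x -> O x -> x <> p -> U1 x \/ U2 x) ->
  (forall x, X x -> O x -> U1 x -> U2 x -> False) ->
  ~ U1 p -> ~ U2 p ->
  (forall N, nbhs p N -> exists2 x, N x & X x /\ U1 x) ->
  (forall N, nbhs p N -> exists2 x, N x & X x /\ U2 x) -> False.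
Proof.
move=> sX Xp oO Op oU1 oU2 UC U0 U1p U2p aU1 aU2.
have [O' [W [oO' O'p oW [h [g [hf gf hK gK [ch cg]]]]]]] := sX p Xp.
have Hhp : (@half_plane R `&` W) (h p) by apply: hf.
have ghp : g (h p) = p by rewrite hK// inE.
have [e e0 eP] : exists2 e : R, 0 < e & forall y, `|h p - y| < e -> half_plane y ->
    W y /\ O (g y).
  move: cg => /subspace_continuousP/(_ _ Hhp) cg.
  have Og : nbhs (g (h p)) O by rewrite ghp; exact: open_nbhs_nbhs.
  have /nbhs_ballP[e1 /= e10 e1P] := cg _ Og.
  have /nbhs_ballP[e2 /= e20 e2P] : nbhs (h p) W.
    by apply: open_nbhs_nbhs; split=> //; exact: Hhp.2.
  exists (Num.min e1 e2); first by rewrite lt_min e10.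
  move=> y; rewrite lt_min => /andP[y1 y2] yH.
  have Wy : W y by apply: e2P; rewrite -ball_normE.
  by split=> //; apply: e1P => //; rewrite -ball_normE.
pose C := [set y | [/\ half_plane y, `|h p - y| < e & y != h p]].
have gC y : C y -> [/\ X (g y), O (g y), O' (g y) & g y <> p].
  move=> [y1 ye yp]; have [Wy Oy] := eP y ye y1.
  have HWy : (@half_plane R `&` W) y by [].
  have [Xg O'g] := gf y HWy; split=> // gyp.
  by move/eqP: yp; apply; rewrite -gyp gK// inE.
have conn : connected (g @` C).
  apply: connected_continuous_connected.
    exact: punctured_half_square_connected e0 Hhp.1.
  apply: continuous_subspaceW cg => y [y1 ye _].
  by have [] := eP y ye y1.
have near_C U : ~ U p -> (forall N, nbhs p N -> exists2 x, N x & X x /\ U x) ->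
    exists2 x, (g @` C) x & U x.
  move=> Up aU; move: ch => /subspace_continuousP/(_ p (conj Xp O'p)) ch.
  have [|x [xN O'x] [Xx Ux]] := aU ([set x | (X `&` O') x -> `|h p - h x| < e] `&` O').
    apply: filterI; last exact: open_nbhs_nbhs.
    have := ch (ball (h p) e) (nbhsx_ballx _ _ e0).
    apply: (@filterS _ _ (nbhs_filter p)) => x /= + Xx.
    by move=> /(_ Xx); rewrite -ball_normE.
  have [Hx Wx] := hf x (conj Xx O'x).
  have ghx : g (h x) = x by rewrite hK// inE.
  exists x => //; exists (h x) => //; split=> //; first exact: xN.
  by apply/eqP => hxp; apply: Up; rewrite -ghp -hxp ghx.
have [x1 gx1 Ux1] := near_C U1 U1p aU1.
have [x2 gx2 Ux2] := near_C U2 U2p aU2.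
have : (g @` C) `&` U1 = g @` C.
  apply: conn; first by exists x1.
    by exists U1.
  exists (~` U2); first exact: open_closedC.
  apply/seteqP; split=> x [[y Cy yx] Ux]; split; try by exists y.
    move=> U2x; have [Xy Oy _ _] := gC y Cy.
    by apply: (U0 x) => //; rewrite -yx.
  have [Xy Oy _ yp] := gC y Cy.
  by have := UC (g y) Xy Oy yp; rewrite yx => -[].
move=> gU1; have [_ U1x2] : (g @` C `&` U1) x2 by rewrite gU1.
case: gx2 => y Cy yx; have [Xy Oy _ _] := gC y Cy.
by apply: (U0 x2) => //; rewrite -yx.
Qed.

End Plane.

(** * Local structure of triangulated surfaces *)

Section Realization.
Variables (R : realType) (n : nat).
Implicit Types (K : {set {set 'I_n}}) (s P : {set 'I_n}) (x y : 'rV[R]_n).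

Definition supp x : {set 'I_n} := [set i | x 0 i != 0]%SET.

(** On a realization this is positive exactly where the support meets [P]; being continuous, it
    turns conditions on supports into open sets. *)
Definition mass P x : R := \sum_(i in P) x 0 i.

Lemma mass_continuous P : continuous (mass P).
Proof.
have c := @continuous_big R 'I_n +%R 0 (fun i => i \in P) (@add_continuous R)
  'rV[R]_n (index_enum 'I_n) (fun i x => x 0 i).
by apply: c => i _; exact: coord_continuous.
Qed.

Lemma open_mass_gt P r : open [set x | r < mass P x].
Proof.
by have /continuousP/(_ _ (open_gt (y := r))) := @mass_continuous P.
Qed.

Lemma mass1 i x : mass [set i]%SET x = x 0 i.
Proof. by rewrite /mass big_set1. Qed.

Lemma open_coord_gt i r : open [set x : 'rV[R]_n | r < x 0 i].
Proof.
rewrite (_ : [set x | _] = [set x | r < mass [set i]%SET x]).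
  exact: open_mass_gt.
by apply/seteqP; split=> x /=; rewrite mass1.
Qed.

Lemma mass_gt0P K P x : realization K x ->
  reflect (exists2 i, i \in P & i \in supp x) (0 < mass P x).
Proof.
move=> [x0 _ _]; apply: (iffP idP) => [|[i iP]].
  apply: contraPP => h; rewrite /mass big1 ?ltxx// => i iP.
  by apply/eqP; apply: contra_notT h => xi; exists i; rewrite ?inE.
rewrite inE => xi; rewrite /mass (bigD1 i)//= ltr_pwDl//.
  by rewrite lt_neqAle eq_sym xi x0.
by apply: sumr_ge0 => j _; exact: x0.
Qed.

Lemma supp_coord K x i : realization K x -> (i \in supp x) = (0 < x 0 i).
Proof. by move=> [x0 _ _]; rewrite inE lt_neqAle eq_sym x0 andbT. Qed.

Definition vertex_point (v : 'I_n) : 'rV[R]_n := delta_mx 0 v.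

Lemma supp_vertex_point v : supp (vertex_point v) = [set v]%SET.
Proof.
by apply/setP => i; rewrite !inE mxE eqxx /=; case: (i == v); rewrite ?oner_eq0 ?eqxx.
Qed.

Lemma realization_vertex_point K v : [set v]%SET \in K ->
  realization K (vertex_point v).
Proof.
move=> vK; split; last by rewrite -/(supp _) supp_vertex_point.
  by move=> i; rewrite mxE ler0n.
rewrite (bigD1 v)//= big1 ?addr0 ?mxE ?eqxx// => i iv.
by rewrite mxE (negbTE iv) andbF.
Qed.

Lemma segment_coord x y t i :
  (x + t *: (y - x)) 0 i = (1 - t) * x 0 i + t * y 0 i.
Proof. by rewrite !mxE; ring. Qed.

(** For [t] strictly between 0 and 1, a coordinate vanishes only if it does so at both ends. *)
Lemma realization_segment K x y t : realization K x -> realization K y ->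
  (supp x :|: supp y)%SET \in K -> 0 < t < 1 ->
  realization K (x + t *: (y - x)) /\
  supp (x + t *: (y - x)) = (supp x :|: supp y)%SET.
Proof.
move=> [x0 x1 _] [y0 y1 _] xyK /andP[t0 t1].
have t10 : 0 < 1 - t by rewrite subr_gt0.
have S : supp (x + t *: (y - x)) = (supp x :|: supp y)%SET.
  apply/setP => i; rewrite !inE segment_coord.
  rewrite paddr_eq0 ?mulr_ge0 ?x0 ?y0 ?(ltW t0) ?(ltW t10)//.
  by rewrite !mulf_eq0 (gt_eqF t0) (gt_eqF t10) negb_and.
split=> //; split; last by rewrite -/(supp _) S.
  by move=> i; rewrite segment_coord addr_ge0// mulr_ge0// ltW.
under eq_bigr do rewrite segment_coord.
by rewrite big_split/= -!mulr_sumr x1 y1; ring.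
Qed.

Lemma cvg_line (V : normedModType R) (q w : V) :
  q + t *: w @[t --> (0 : R)] --> q.
Proof.
rewrite -{2}[q]addr0 -(scale0r w).
by apply: cvgD; [exact: cvg_cst|apply: cvgZ; [exact: cvg_id|exact: cvg_cst]].
Qed.

Lemma near_segment x y N : nbhs x N ->
  exists2 t, 0 < t < 1 & N (x + t *: (y - x)).
Proof.
move=> xN.
have c : x + t *: (y - x) @[t --> (0 : R)] --> x.
  exact: cvg_line.
have /nbhs_ballP[d /= d0 dN] := c _ xN.
exists (Num.min (d / 2) (1 / 2)).
  by rewrite lt_min gt_min !divr_gt0//=; apply/orP; right; lra.
apply: dN; rewrite -ball_normE /= sub0r normrN gtr0_norm ?lt_min ?divr_gt0//.
by rewrite gt_min; apply/orP; left; lra.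
Qed.

End Realization.

(** * Connectedness of the skeleton and of links; purity *)

Section Surface.
Variables (R : realType) (n : nat) (K : {set {set 'I_n}}).
Hypothesis hK : triangulated_surface R K.
Implicit Types (s P : {set 'I_n}) (x y : 'rV[R]_n) (a b c d v w : 'I_n).

Let X := @realization R n K.

Let Ksub s (t : {set 'I_n}) : s \in K -> t \subset s -> t \in K.
Proof. by case: hK => + _ _; exact. Qed.

Lemma supp_in x : X x -> supp x \in K.
Proof. by case. Qed.

Lemma supp_sub_in x s : X x -> s \subset supp x -> s \in K.
Proof. by move=> /supp_in xK; exact: Ksub. Qed.

Lemma realization_supp1 x v : X x -> supp x \subset [set v]%SET ->
  x = vertex_point R v.
Proof.
move=> [x0 x1 _] /fintype.subsetP xv.
have xi i : i != v -> x 0 i = 0.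
  by move=> iv; apply/eqP; apply: contraNT iv => xi; rewrite -finset.in_set1 xv// inE.
apply/rowP => i; rewrite mxE /=; case: eqP => [->|/eqP/xi//].
by move: x1; rewrite (bigD1 v)//= big1// addr0 => ->.
Qed.

(** No simplex meets both [P] and its complement, so having positive mass on [P] is both open and
    closed on the connected realization. *)
Lemma skeleton_connected P v0 v : [set v0]%SET \in K -> [set v]%SET \in K ->
  (forall a b, [set a; b]%SET \in K -> a \in P -> b \in P) ->
  v0 \in P -> v \in P.
Proof.
move=> v0K vK PP v0P; case: hK => _ cX _.
have mixed x a b : X x -> a \in supp x -> b \in supp x -> a \in P -> b \in P.
  move=> Xx ax bx; apply: PP; apply: supp_sub_in Xx _.
  by apply/fintype.subsetP => i; rewrite finset.in_set2 => /orP[]/eqP->.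
have : X `&` [set x | 0 < mass P x] = X.
  apply: cX.
  - exists (vertex_point R v0); split; first exact: realization_vertex_point.
    apply/(mass_gt0P _ (realization_vertex_point R v0K)).
    by exists v0 => //; rewrite supp_vertex_point inE.
  - by exists [set x | 0 < mass P x] => //; exact: open_mass_gt.
  - exists (~` [set x | 0 < mass (~: P)%SET x]).
      by apply: open_closedC; exact: open_mass_gt.
    apply/seteqP; split=> x /= [Xx] => [/(mass_gt0P P Xx)[a aP ax]|xP].
      split=> // /(mass_gt0P _ Xx)[b]; rewrite inE => /negP bP bx.
      by apply: bP; exact: (mixed x a).
    split=> //; apply/(mass_gt0P P Xx); have [_ x1 _] := Xx.
    have [i xi] : exists i, i \in supp x.
      apply: contrapT => h; have /eqP := x1; rewrite big1 ?(eq_sym 0) ?oner_eq0//.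
      by move=> i _; apply/eqP; apply: contra_notT h => xi; exists i; rewrite inE.
    exists i => //; apply: contrapT => /negP iP; apply: xP.
    by apply/(mass_gt0P _ Xx); exists i => //; rewrite inE.
move=> XP; have [_ /=] : (X `&` [set x | 0 < mass P x]) (vertex_point R v).
  by rewrite XP; exact: realization_vertex_point.
move=> /(mass_gt0P _ (realization_vertex_point R vK))[i iP].
by rewrite supp_vertex_point inE => /eqP <-.
Qed.

(** Otherwise, in the open star of [v], the masses of [P] and of its complement, both without [v],
    are positive on disjoint open sets accumulating at [v], which makes [v] a local cut point. *)
Lemma link_connected v w0 w P : w0 != v -> w != v ->
  [set v; w0]%SET \in K -> [set v; w]%SET \in K ->
  (forall a b, a != v -> b != v -> [set v; a; b]%SET \in K -> a \in P -> b \in P) ->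
  w0 \in P -> w \in P.
Proof.
move=> w0v wv w0K wK PP w0P; apply: contrapT => /negP wP.
have [_ _ sX] := hK.
have vK : [set v]%SET \in K by apply: Ksub w0K _; rewrite finset.subsetUl.
have Xv : X (vertex_point R v) by exact: realization_vertex_point.
have near_v (Q : {set 'I_n}) u N : u != v -> [set v; u]%SET \in K -> u \in Q ->
    nbhs (vertex_point R v) N ->
    exists2 x, N x & X x /\ 0 < mass (Q :\ v)%SET x.
  move=> uv uK uQ /(near_segment (vertex_point R u))[t t01 Nt].
  have Xu : X (vertex_point R u).
    by apply: realization_vertex_point; apply: Ksub uK _; rewrite finset.subsetUr.
  have [|Xt st] := realization_segment Xv Xu _ t01.
    by rewrite !supp_vertex_point.
  exists (vertex_point R v + t *: (vertex_point R u - vertex_point R v)) => //.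
  split=> //; apply/(mass_gt0P _ Xt); exists u; first by rewrite !inE uv.
  by rewrite st !supp_vertex_point !inE eqxx orbT.
apply: (@surface_not_cut R _ X (vertex_point R v) [set x | 0 < x 0 v]
  [set x | 0 < mass (P :\ v)%SET x] [set x | 0 < mass (~: P :\ v)%SET x]) => //.
- exact: open_coord_gt.
- by rewrite /= -(supp_coord _ Xv) supp_vertex_point inE.
- exact: open_mass_gt.
- exact: open_mass_gt.
- move=> x Xx _ xv.
  have [i iv xi] : exists2 i, i != v & i \in supp x.
    apply: contrapT => h; apply: xv; apply: realization_supp1 => //.
    apply/fintype.subsetP => i xi; rewrite inE; apply: contrapT => /negP iv.
    by apply: h; exists i.
  have [iP|iP] := boolP (i \in P); [left|right];
    by apply/(mass_gt0P _ Xx); exists i; rewrite // !inE iv.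
- move=> x Xx; rewrite /= -(supp_coord _ Xx) => vx.
  move=> /(mass_gt0P _ Xx)[a /finset.setD1P[av aP] ax].
  move=> /(mass_gt0P _ Xx)[b /finset.setD1P[bv]]; rewrite inE => /negP bP bx.
  apply: bP; apply: PP av bv _ aP; apply: supp_sub_in Xx _.
  apply/fintype.subsetP => i; rewrite finset.in_setU in_set2 finset.in_set1.
  by move=> /orP[/orP[]|]/eqP->.
- move=> /(mass_gt0P _ Xv)[i]; rewrite supp_vertex_point !inE => /andP[iv _].
  by rewrite (negbTE iv).
- move=> /(mass_gt0P _ Xv)[i]; rewrite supp_vertex_point !inE => /andP[iv _].
  by rewrite (negbTE iv).
- by move=> N; exact: near_v w0v w0K w0P.
- by move=> N; apply: near_v wv wK _; rewrite inE.
Qed.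

Definition midpoint a b : 'rV[R]_n :=
  vertex_point R a + 2^-1 *: (vertex_point R b - vertex_point R a).

Lemma realization_midpoint a b : [set a; b]%SET \in K ->
  X (midpoint a b) /\ supp (midpoint a b) = [set a; b]%SET.
Proof.
move=> abK; rewrite -(supp_vertex_point R a) -(supp_vertex_point R b).
apply: realization_segment; rewrite ?supp_vertex_point//.
- by apply: realization_vertex_point; apply: Ksub abK _; rewrite finset.subsetUl.
- by apply: realization_vertex_point; apply: Ksub abK _; rewrite finset.subsetUr.
- by rewrite invr_gt0 invf_lt1 ?ltr0n//= ltr1n.
Qed.

Lemma sum_supp (f : 'I_n -> R) (r : seq 'I_n) : uniq r ->
  (forall i, i \notin r -> f i = 0) -> \sum_i f i = \sum_(i <- r) f i.
Proof.
move=> ur fr; rewrite [RHS]big_uniq//= [LHS](bigID (mem r))/=.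
by rewrite [X in _ + X]big1 ?addr0.
Qed.

(** If no triangle contained the edge, all points with positive coordinates at [a] and [b] would lie
    on it, and its midpoint would be a local cut point. *)
Lemma edge_in_triangle a b : a != b -> [set a; b]%SET \in K ->
  exists2 c, c \notin [set a; b]%SET & [set a; b; c]%SET \in K.
Proof.
move=> ab abK; apply: contrapT => h; have [_ _ sX] := hK.
have [Xm sm] := realization_midpoint abK.
have only x : X x -> 0 < x 0 a -> 0 < x 0 b -> supp x = [set a; b]%SET.
  move=> Xx; rewrite -!(supp_coord _ Xx) => xa xb.
  apply/eqP; rewrite eq_sym finset.eqEsubset; apply/andP; split.
    by apply/fintype.subsetP => i; rewrite finset.in_set2 => /orP[]/eqP->.
  apply/fintype.subsetP => c xc; apply: contrapT => /negP cab; apply: h; exists c => //.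
  apply: supp_sub_in Xx _.
  apply/fintype.subsetP => i; rewrite finset.in_setU in_set2 finset.in_set1.
  by move=> /orP[/orP[]|]/eqP->.
have sum2 x : X x -> supp x = [set a; b]%SET -> x 0 a + x 0 b = 1.
  move=> [_ <- _] sx; rewrite (@sum_supp _ [:: a; b]) /= ?inE ?ab//.
    by rewrite big_cons big_seq1.
  move=> i; rewrite !inE -finset.in_set2 => iab; apply/eqP; apply: contraNT iab => xi.
  by rewrite -sx inE.
have ma : midpoint a b 0 a = 1 / 2.
  by rewrite !mxE !eqxx (negbTE ab) /=; lra.
have mb : midpoint a b 0 b = 1 / 2.
  by rewrite !mxE !eqxx [b == a]eq_sym (negbTE ab) /=; lra.
have near_m u N : u \in [set a; b]%SET -> nbhs (midpoint a b) N ->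
    exists2 x, N x & X x /\ 1 / 2 < x 0 u.
  move=> uab /(near_segment (vertex_point R u))[t t01 Nt].
  have Xu : X (vertex_point R u).
    by apply: realization_vertex_point; apply: Ksub abK _; rewrite finset.sub1set.
  have [|Xt st] := realization_segment Xm Xu _ t01.
    rewrite supp_vertex_point sm (_ : ([set a; b] :|: [set u])%SET = [set a; b]%SET)//.
    by apply/finset.setUidPl; rewrite finset.sub1set.
  exists (midpoint a b + t *: (vertex_point R u - midpoint a b)) => //.
  split=> //; case/andP: t01 => t0 t1.
  have mu : midpoint a b 0 u = 1 / 2 by move: uab; rewrite finset.in_set2 => /orP[]/eqP->.
  by rewrite /= segment_coord mu mxE !eqxx /=; lra.
apply: (@surface_not_cut R _ X (midpoint a b)
    ([set x | 0 < x 0 a] `&` [set x | 0 < x 0 b])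
  [set x | 1 / 2 < x 0 a] [set x | 1 / 2 < x 0 b]) => //.
- by apply: openI; exact: open_coord_gt.
- by split; rewrite /= ?ma ?mb; lra.
- exact: open_coord_gt.
- exact: open_coord_gt.
- move=> x Xx [xa xb] xm; have xab := sum2 x Xx (only x Xx xa xb).
  have [?|xa2] := ltP (1 / 2) (x 0 a); first by left.
  have [?|xb2] := ltP (1 / 2) (x 0 b); first by right.
  case: xm; apply/rowP => i.
  have [->|ia] := eqVneq i a; first by rewrite ma; lra.
  have [->|ib] := eqVneq i b; first by rewrite mb; lra.
  transitivity (0 : R); apply/eqP.
    rewrite -[_ == _]negbK; have := only x Xx xa xb.
    by move=> /finset.setP/(_ i); rewrite !inE (negbTE ia) (negbTE ib) => ->.
  move/finset.setP/(_ i): sm; rewrite !inE (negbTE ia) (negbTE ib) => /negbT.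
  by rewrite negbK eq_sym.
- move=> x Xx [xa xb]; have := sum2 x Xx (only x Xx xa xb) => /=; lra.
- by rewrite /= ma ltxx.
- by rewrite /= mb ltxx.
- by move=> N; apply: near_m; rewrite finset.set21.
- by move=> N; apply: near_m; rewrite finset.set22.
Qed.

End Surface.

Lemma continuous_row (R : realType) n (T : topologicalType) (f : T -> 'rV[R]_n) :
  (forall i, continuous (fun x => f x 0 i)) -> continuous f.
Proof.
move=> cf x B [P xP PB].
have h : \forall y \near x, forall i, P 0 i (f y 0 i).
  by apply: filter_forall => i; exact: cf (xP 0 i).
apply: (@filterS _ _ (nbhs_filter x) _ _ _ h) => y Py; apply: PB => i j.
by rewrite (ord1 i).
Qed.

Lemma sub_continuous (R : realType) (T : topologicalType) (f g : T -> R) :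
  continuous f -> continuous g -> continuous (fun z => f z - g z).
Proof. by move=> cf cg z; apply: cvgB; [exact: cf|exact: cg]. Qed.

(** * Two triangles glued along an edge *)

Section Book.
Variables (R : realType) (n : nat) (K : {set {set 'I_n}}).
Variables (a b c c' : 'I_n).
Hypothesis abcc' : uniq [:: a; b; c; c'].
Implicit Types x : 'rV[R]_n.

(* The triangles {a, b, c} and {a, b, c'} glued along {a, b} and flattened in the
   plane: s is the coordinate along the edge, t > 0 on the page of c and t < 0 on
   that of c'. *)
Definition book (s t : R) : 'rV[R]_n :=
  \row_i if i == a then (1 - `|t| + s) / 2 else if i == b then (1 - `|t| - s) / 2
    else if i == c then Num.max t 0 else if i == c' then Num.max (- t) 0 else 0.

Definition unbook x : 'rV[R]_2 := pt (x 0 a - x 0 b) (x 0 c - x 0 c').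

Let neqs : [/\ (b == a) = false, (c == a) = false, (c' == a) = false,
  (c == b) = false & (c' == b) = false /\ (c' == c) = false].
Proof.
move: abcc'; rewrite /= !inE !negb_or => /and4P[/and3P[ab ac ac'] /andP[bc bc'] cc' _].
by split; [| | | | split]; rewrite eq_sym; apply/negbTE.
Qed.

Lemma book_a s t : book s t 0 a = (1 - `|t| + s) / 2.
Proof. by rewrite mxE eqxx. Qed.

Lemma book_b s t : book s t 0 b = (1 - `|t| - s) / 2.
Proof. by case: neqs => ba _ _ _ _; rewrite mxE ba eqxx. Qed.

Lemma book_c s t : book s t 0 c = Num.max t 0.
Proof. by case: neqs => _ ca _ cb _; rewrite mxE ca cb eqxx. Qed.

Lemma book_c' s t : book s t 0 c' = Num.max (- t) 0.
Proof. by case: neqs => _ _ c'a _ [c'b c'c]; rewrite mxE c'a c'b c'c eqxx. Qed.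

Lemma book_out s t i : i \notin [:: a; b; c; c'] -> book s t 0 i = 0.
Proof.
rewrite !inE !negb_or => /and4P[/negbTE ia /negbTE ib /negbTE ic /negbTE ic'].
by rewrite mxE ia ib ic ic'.
Qed.

Lemma book_continuous (T : topologicalType) (p q : T -> R) :
  continuous p -> continuous q -> continuous (fun z => book (p z) (q z)).
Proof.
move=> cp cq; apply: continuous_row => i.
rewrite (_ : (fun z => book (p z) (q z) 0 i) = fun z =>
    if i == a then (1 - `|q z| + p z) / 2
    else if i == b then (1 - `|q z| - p z) / 2
    else if i == c then Num.max (q z) 0
    else if i == c' then Num.max (- q z) 0 else 0);
  last by apply/funext => z; rewrite mxE.
case: (i == a); [|case: (i == b); [|case: (i == c); [|case: (i == c')]]] => z.
- apply: cvgM; last exact: cvg_cst; apply: cvgD; last exact: cp.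
  by apply: cvgB; [exact: cvg_cst|exact: cvg_norm (cq z)].
- apply: cvgM; last exact: cvg_cst; apply: cvgB; last exact: cp.
  by apply: cvgB; [exact: cvg_cst|exact: cvg_norm (cq z)].
- exact: (@continuous_max R T q (fun=> 0) z (cq z) (cvg_cst _)).
- exact: (@continuous_max R T (fun y => - q y) (fun=> 0) z (cvgN (cq z)) (cvg_cst _)).
- exact: cvg_cst.
Qed.

Lemma unbook_continuous : continuous unbook.
Proof.
have cc (i j : 'I_n) : continuous (fun x => x 0 i - x 0 j).
  exact: (sub_continuous (@coord_continuous R 1 n 0 i) (@coord_continuous R 1 n 0 j)).
apply: continuous_row => i; rewrite /unbook.
rewrite (_ : (fun x => _) = fun x : 'rV[R]_n =>
    if i == 0 then x 0 a - x 0 b else x 0 c - x 0 c').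
  by case: (i == 0); exact: cc.
by apply/funext => x; rewrite mxE.
Qed.

Lemma bookK s t : unbook (book s t) = pt s t.
Proof.
rewrite /unbook book_a book_b book_c book_c'; congr pt; first lra.
by case: (leP t 0) => t0; [rewrite max_l|rewrite max_r]; lra.
Qed.

(** On either page one of the coordinates at [c] and [c'] is 0, so their difference determines both;
    the total 1 then gives the coordinates at [a] and [b] from their difference. *)
Lemma unbookK x : realization K x -> supp x \subset [set a; b; c]%SET \/
  supp x \subset [set a; b; c']%SET ->
  book (x 0 a - x 0 b) (x 0 c - x 0 c') = x.
Proof.
move=> [x0 x1 _] xs; have [ba ca c'a cb [c'b c'c]] := neqs.
have out i : i \notin [:: a; b; c; c'] -> x 0 i = 0.
  rewrite !inE !negb_or => /and4P[ia ib ic ic'].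
  apply/eqP; rewrite -[_ == _]negbK; apply/negP => xi.
  case: xs => /fintype.subsetP/(_ i); rewrite !inE xi => /(_ isT);
    by rewrite (negbTE ia) (negbTE ib) ?(negbTE ic) ?(negbTE ic').
have sum4 : x 0 a + x 0 b + (x 0 c + x 0 c') = 1.
  rewrite -x1 (sum_supp abcc' out) !big_cons big_nil; ring.
have cc' : x 0 c = 0 \/ x 0 c' = 0.
  case: xs => /fintype.subsetP xs; [right|left]; apply/eqP; rewrite -[_ == _]negbK;
    apply/negP => xi.
    by have := xs c'; rewrite !inE xi c'a c'b c'c => /(_ isT).
  by have := xs c; rewrite !inE xi ca cb eq_sym c'c => /(_ isT).
have [xc xc'] := (x0 c, x0 c').
have E : [/\ `|x 0 c - x 0 c'| = x 0 c + x 0 c', Num.max (x 0 c - x 0 c') 0 = x 0 c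
    & Num.max (- (x 0 c - x 0 c')) 0 = x 0 c'].
  case: cc' => ->.
    rewrite sub0r normrN add0r opprK ger0_norm// max_r ?oppr_le0//.
    by rewrite max_l.
  rewrite subr0 addr0 ger0_norm// max_l//.
  by rewrite max_r ?oppr_le0.
case: E => E1 E2 E3; apply/rowP => i.
have [iabcc'|/[dup] iabcc' /out ->] := boolP (i \in [:: a; b; c; c']); last first.
  exact: book_out.
move: iabcc'; rewrite !inE => /or4P[] /eqP ->.
- rewrite book_a E1; lra.
- rewrite book_b E1; lra.
- by rewrite book_c.
- by rewrite book_c'.
Qed.

Hypothesis Ksub : simplicial_complex K.
Hypothesis abcK : [set a; b; c]%SET \in K.
Hypothesis abc'K : [set a; b; c']%SET \in K.

(** The diamond is the region where the coordinates at [a] and [b] stay positive; the sign of [t]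
    chooses the page. *)
Lemma book_realization s t : `|s| + `|t| < 1 ->
  [/\ realization K (book s t), 0 < book s t 0 a, 0 < book s t 0 b &
    supp (book s t) \subset [set a; b; c]%SET \/
    supp (book s t) \subset [set a; b; c']%SET].
Proof.
move=> st; have ps : s <= `|s| by rewrite ler_norm.
have ns : - s <= `|s| by rewrite -normrN ler_norm.
have a0 : 0 < book s t 0 a by rewrite book_a; lra.
have b0 : 0 < book s t 0 b by rewrite book_b; lra.
have sub : supp (book s t) \subset [set a; b; c]%SET \/
    supp (book s t) \subset [set a; b; c']%SET.
  have [t0|t0] := leP 0 t; [left|right]; apply/fintype.subsetP => i.
    rewrite !inE => ti; have [|/book_out ti0] := boolP (i \in [:: a; b; c; c']); last first.
      by rewrite ti0 eqxx in ti.
    rewrite !inE => /or4P[] /eqP ii; rewrite ii ?eqxx ?orbT//.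
    by move: ti; rewrite ii book_c' max_r ?eqxx// oppr_le0.
  rewrite !inE => ti; have [|/book_out ti0] := boolP (i \in [:: a; b; c; c']); last first.
    by rewrite ti0 eqxx in ti.
  rewrite !inE => /or4P[] /eqP ii; rewrite ii ?eqxx ?orbT//.
  by move: ti; rewrite ii book_c max_r ?eqxx// ltW.
split=> //; split.
- move=> i; have [|/book_out->//] := boolP (i \in [:: a; b; c; c']).
  rewrite !inE => /or4P[] /eqP ->; [exact: ltW|exact: ltW| |].
    by rewrite book_c le_max lexx orbT.
  by rewrite book_c' le_max lexx orbT.
- rewrite (sum_supp abcc' (@book_out s t)) !big_cons big_nil.
  rewrite book_a book_b book_c book_c' addr0.
  have [t0|t0] : 0 <= t \/ t < 0 by case: (leP 0 t); [left|right].
    by rewrite max_l// max_r ?oppr_le0// ger0_norm//; lra.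
  by rewrite max_r ?ltW// max_l ?oppr_ge0 ?ltW// ltr0_norm//; lra.
- by rewrite -/(supp _); case: sub => h; [exact: Ksub abcK h|exact: Ksub abc'K h].
Qed.

End Book.

(** * Cofaces of edges and detection of the boundary *)

Section SurfaceEdges.
Variables (R : realType) (n : nat) (K : {set {set 'I_n}}).
Hypothesis hK : triangulated_surface R K.
Implicit Types (s P : {set 'I_n}) (x : 'rV[R]_n) (a b c d v w : 'I_n).

Let X := @realization R n K.

Let Ksub : simplicial_complex K. Proof. by case: hK. Qed.

Lemma realization_supp_exists s : s \in K -> s != finset.set0 ->
  exists2 x, X x & supp x = s.
Proof.
move=> sK s0; have s1 : #|s|%:R != 0 :> R by rewrite pnatr_eq0 cards_eq0.
pose x : 'rV[R]_n := \row_i (if i \in s then #|s|%:R^-1 else 0).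
have sx : supp x = s.
  by apply/finset.setP => i; rewrite inE mxE; case: ifP; rewrite ?invr_eq0 ?s1 ?eqxx.
exists x => //; split; last by rewrite -/(supp x) sx.
  by move=> i; rewrite mxE; case: ifP; rewrite // invr_ge0 ler0n.
under eq_bigr do rewrite mxE.
by rewrite -big_mkcond/= sumr_const -[X in X = _]mulr_natl mulfV.
Qed.

Lemma midpoint_coord a b i : i \notin [set a; b]%SET -> midpoint R a b 0 i = 0.
Proof.
rewrite !inE negb_or => /andP[/negbTE ia /negbTE ib].
by rewrite /midpoint segment_coord !mxE ia ib !andbF /=; ring.
Qed.

Lemma midpoint_coord2 a b i : a != b -> i \in [set a; b]%SET ->
  midpoint R a b 0 i = 1 / 2.
Proof.
move=> /negbTE ab; rewrite !inE /midpoint segment_coord !mxE eqxx /=.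
by move=> /orP[]/eqP->; rewrite eqxx ?[b == a]eq_sym ab /=; lra.
Qed.

Lemma book0 a b c c' : uniq [:: a; b; c; c'] -> [set a; b]%SET \in K ->
  book a b c c' 0 0 = midpoint R a b.
Proof.
move=> u abK; have [Xm sm] := realization_midpoint hK abK.
have ab : a != b by move: u; rewrite /= !inE !negb_or => /andP[/and3P[]].
rewrite -[RHS](unbookK u Xm); last by left; rewrite sm finset.subsetUl.
congr book; first by rewrite !midpoint_coord2 ?subrr ?finset.set21 ?finset.set22.
move: u; rewrite /= !inE !negb_or => /and4P[/and3P[_ ac ac'] /andP[bc bc'] _ _].
by rewrite !midpoint_coord ?subrr// !inE !negb_or ![_ == a]eq_sym ![_ == b]eq_sym
  ?ac ?bc ?ac' ?bc'.
Qed.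

Let D := [set y : 'rV[R]_2 | `|y 0 0| + `|y 0 ord_max| < 1].

Let D_open : open D.
Proof.
have cn (T : topologicalType) (f g : T -> R) : continuous f -> continuous g ->
    continuous (fun z => `|f z| + `|g z|).
  by move=> cf cg z; apply: cvgD; [exact: cvg_norm (cf z)|exact: cvg_norm (cg z)].
have := cn _ _ _ (@coord_continuous R 1 2 0 0) (@coord_continuous R 1 2 0 ord_max).
by move=> /continuousP/(_ _ (open_lt (y := 1))).
Qed.

Let book_coord_continuous a b c c' :
  continuous (fun y : 'rV[R]_2 => book a b c c' (y 0 0) (y 0 ord_max)).
Proof. by apply: book_continuous; exact: coord_continuous. Qed.

(* By invariance of domain the two triangles fill a neighbourhood of the midpoint
   of their common edge, which leaves no room for another coface. *)
Lemma edge_cofaces a b c c' s : uniq [:: a; b; c; c'] ->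
  [set a; b; c]%SET \in K -> [set a; b; c']%SET \in K ->
  s \in K -> a \in s -> b \in s ->
  s \subset [set a; b; c]%SET \/ s \subset [set a; b; c']%SET.
Proof.
move=> u abcK abc'K sK sa sb.
have abK : [set a; b]%SET \in K by apply: Ksub abcK _; rewrite finset.subsetUl.
pose phi (y : 'rV[R]_2) := book a b c c' (y 0 0) (y 0 ord_max).
have [Xm sm] := realization_midpoint hK abK.
have phi0 : phi 0 = midpoint R a b by rewrite /phi !mxE book0.
have [_ _ sX] := hK.
have [O [W [oO Om oW [h [g [hf gf hK' gK [ch cg]]]]]]] := sX _ Xm.
pose A := D `&` [set y | O (phi y)].
have D0 : D 0 by rewrite /D /= !mxE normr0 addr0.
have oA : open A.
  apply: openI => //.
  by have /continuousP/(_ _ oO) := @book_coord_continuous a b c c'.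
have XA y : A y -> (X `&` O) (phi y).
  by move=> [yD Oy]; split=> //; have [] := book_realization u Ksub abcK abc'K yD.
have nA : nbhs (h (phi 0)) ((h \o phi) @` A).
  apply: invariance_of_domain.
  - by apply: open_nbhs_nbhs; split=> //; split=> //=; rewrite phi0.
  - apply: within_continuous_comp ch _ XA.
    exact: continuous_subspaceT (@book_coord_continuous a b c c').
  - move=> x y Ax Ay /= hxy; have := congr1 g hxy.
    rewrite !hK' ?inE; [|exact: XA|exact: XA].
    by move=> /(congr1 (unbook a b c c')); rewrite !bookK// -!pt_eta.
(* A small move from the midpoint towards a point [q] of support [s] leads to a point which has
   support [s], as [a] and [b] are in [s], and which is reached by [phi]; so [s] lies on one
   page. *)
have [|q Xq sq] := realization_supp_exists sK.
  by apply/finset.set0Pn; exists a.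
move: nA; rewrite phi0 => nA.
have /subspace_continuousP ch' := ch.
have ch1 : nbhs (midpoint R a b)
    [set x | (X `&` O) x -> ((h \o phi) @` A) (h x)].
  exact: (ch' (midpoint R a b) (conj Xm Om) _ nA).
have [t t01 [Ht Ot]] :=
  near_segment q (filterI ch1 (open_nbhs_nbhs (conj oO Om))).
have abs : (supp (midpoint R a b) :|: supp q)%SET = s.
  rewrite sm sq; apply/finset.setUidPr/fintype.subsetP => i.
  by rewrite finset.in_set2 => /orP[]/eqP->.
have [|Xt st] := realization_segment Xm Xq _ t01; first by rewrite abs.
have [y Ay] := Ht (conj Xt Ot); rewrite /= => hy.
have := congr1 g hy; rewrite !hK' ?inE; [|by split|exact: XA].
move=> py; rewrite -abs -st -py.
by case: Ay => yD _; have [] := book_realization u Ksub abcK abc'K yD.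
Qed.

(* Otherwise points of the edge close to a would have planar neighbourhoods, which
   the coordinates at b and c would map onto open sets of the half plane. *)
Lemma corner_not_interior a b c : uniq [:: a; b; c] -> [set a; b; c]%SET \in K ->
  (forall d, d \notin [set a; b]%SET -> [set a; b; d]%SET \in K -> d = c) ->
  ~ surface_interior R X (vertex_point R a).
Proof.
move=> u abcK only_c [Xa [O [W [oO Oa oW [h [g [hf gf hK' gK [ch cg]]]]]]]].
have abK : [set a; b]%SET \in K by apply: Ksub abcK _; rewrite finset.subsetUl.
have Xb : X (vertex_point R b).
  by apply: realization_vertex_point; apply: Ksub abK _; rewrite finset.subsetUr.
have [t t01 Ot] := near_segment (vertex_point R b) (open_nbhs_nbhs (conj oO Oa)).
have [|Xt st] := realization_segment Xa Xb _ t01.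
  by rewrite !supp_vertex_point.
move: Ot Xt st; set m := _ + _ => Om Xm; rewrite !supp_vertex_point => sm.
have Wm : W (h m) by apply: hf.
have ghm : g (h m) = m by rewrite hK'// inE.
pose A := W `&` [set y | W y -> 0 < g y 0 a] `&` [set y | W y -> 0 < g y 0 b].
have nA : nbhs (h m) A.
  have /subspace_continuousP cg' := cg.
  have gWm B : nbhs m B -> nbhs (h m) [set y | W y -> B (g y)].
    by rewrite -{1}ghm => mB; exact: (cg' (h m) Wm _ mB).
  apply: filterI; first apply: filterI; first exact: open_nbhs_nbhs.
    apply: (gWm [set x | 0 < x 0 _]); apply: open_nbhs_nbhs.
    split; first exact: open_coord_gt.
    by rewrite /= -(supp_coord _ Xm) sm finset.set21.
  apply: (gWm [set x | 0 < x 0 _]); apply: open_nbhs_nbhs.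
  split; first exact: open_coord_gt.
  by rewrite /= -(supp_coord _ Xm) sm finset.set22.
have XA y : A y -> X (g y) /\ supp (g y) \subset [set a; b; c]%SET.
  move=> [[Wy /(_ Wy) ya] /(_ Wy) yb]; have [Xy _] := gf y Wy; split=> //.
  move: ya yb; rewrite -!(supp_coord _ Xy) => ya yb.
  apply/fintype.subsetP => d dy; rewrite finset.in_setU finset.in_set1.
  have [//|dab] := boolP (d \in [set a; b]%SET); apply/eqP; apply: only_c dab _.
  apply: (supp_sub_in hK Xy); apply/fintype.subsetP => i.
  by rewrite finset.in_setU finset.in_set1 finset.in_set2 => /orP[/orP[]|]/eqP->.
have out y i : A y -> i \notin [:: a; b; c] -> g y 0 i = 0.
  move=> Ay iabc; have [Xy /fintype.subsetP yabc] := XA y Ay.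
  apply/eqP; apply: contraNT iabc => yi.
  have := yabc i; rewrite !inE yi => /(_ isT).
  by rewrite orbA.
(* Near [m] only the triangle [{a, b, c}] is present, so the coordinates at [b] and [c] determine a
   point, the one at [a] completing the sum to 1. *)
pose f (y : 'rV[R]_2) := pt (g y 0 b) (g y 0 c).
have nf : nbhs (f (h m)) (f @` A).
  apply: invariance_of_domain => //.
  - apply: (within_continuous_comp (A := setT) (p := g)
      (f := fun x : 'rV[R]_n => pt (x 0 b) (x 0 c))) => //.
      apply: continuous_subspaceT; apply: continuous_row => i.
      rewrite (_ : (fun x => _) = fun x : 'rV[R]_n => if i == 0 then x 0 b else x 0 c).
        by case: (i == 0); exact: coord_continuous.
      by apply/funext => x; rewrite mxE.
    by apply: continuous_subspaceW cg => y [[]].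
  - move=> x y Ax Ay fxy.
    have sum3 z : A z -> g z 0 a + (g z 0 b + g z 0 c) = 1.
      move=> Az; have [[_ <- _] _] := XA z Az.
      by rewrite (sum_supp u (fun i => @out z i Az)) !big_cons big_nil addr0.
    have yb : g x 0 b = g y 0 b.
      by have := congr1 (fun z : 'rV[R]_2 => z 0 0) fxy; rewrite !pt0.
    have yc : g x 0 c = g y 0 c.
      by have := congr1 (fun z : 'rV[R]_2 => z 0 ord_max) fxy; rewrite !pt1.
    have ya : g x 0 a = g y 0 a by have := sum3 x Ax; have := sum3 y Ay; lra.
    have : g x = g y.
      apply/rowP => i; have [|ic] := boolP (i \in [:: a; b; c]); last by rewrite !out.
      by rewrite !inE => /or3P[]/eqP->.
    move=> /(congr1 h); rewrite !gK// inE; [by case: Ay => -[]|by case: Ax => -[]].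
have mc : m 0 c = 0.
  apply/eqP; rewrite -[_ == _]negbK; apply/negP => mc.
  move/finset.setP/(_ c): sm; rewrite !inE mc; move: u.
  by rewrite /= !inE !negb_or ![c == _]eq_sym => /and3P[/andP[_ /negbTE ->] /negbTE ->].
have /nbhs_ballP[d /= d0 dA] := nf.
(* The open image contains a point with a negative coordinate at [c], which no point of the
   realization has. *)
have [|y Ay fy] := dA (pt (m 0 b) (- (d / 2))).
  rewrite -ball_normE /= /f ghm pt_sub subrr mc sub0r opprK norm_pt normr0.
  by rewrite gt_max d0 gtr0_norm; lra.
have [[gy0 _ _] _] := XA y Ay.
have := congr1 (fun z : 'rV[R]_2 => z 0 ord_max) fy; rewrite !pt1 => gyc.
by have := gy0 c; rewrite gyc; lra.
Qed.

Lemma closed_simplex_vertex v x : closed_simplex [set v]%SET x ->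
  x = vertex_point R v.
Proof.
move=> vx; apply: (realization_supp1 vx).
by have [_ _] := vx; rewrite powersetE.
Qed.

Lemma boundary_edge_vertex a b c : uniq [:: a; b; c] -> [set a; b; c]%SET \in K ->
  (forall d, d \notin [set a; b]%SET -> [set a; b; d]%SET \in K -> d = c) ->
  [set a]%SET \in boundary_complex R K.
Proof.
move=> u abcK only_c.
have aK : [set a]%SET \in K by apply: Ksub abcK _; rewrite -finset.setUA finset.subsetUl.
rewrite inE aK; apply/asboolP => x /closed_simplex_vertex ->; split.
  exact: realization_vertex_point.
exact: corner_not_interior u abcK only_c.
Qed.

(** By [edge_cofaces] the two triangles cover the open star of the edge, so [unbook] and [book]
    identify it with the diamond [D] and the midpoint is interior, while a simplex of the boundary
    complex consists of boundary points. *)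
Lemma interior_edge a b c c' : uniq [:: a; b; c; c'] ->
  [set a; b; c]%SET \in K -> [set a; b; c']%SET \in K ->
  [set a; b]%SET \notin boundary_complex R K.
Proof.
move=> u abcK abc'K; rewrite inE negb_and; apply/orP; right; apply/asboolPn => abX.
have abK : [set a; b]%SET \in K by apply: Ksub abcK _; rewrite finset.subsetUl.
have [Xm sm] := realization_midpoint hK abK.
have [_ []] : surface_boundary R X (midpoint R a b).
  apply: abX; case: Xm => m0 m1 _; split=> //.
  by rewrite -/(supp _) sm powersetE.
split=> //.
pose O : set 'rV[R]_n := [set x | 0 < x 0 a] `&` [set x | 0 < x 0 b].
have XO x : (X `&` O) x -> supp x \subset [set a; b; c]%SET \/
    supp x \subset [set a; b; c']%SET.
  move=> [Xx [xa xb]]; apply: edge_cofaces u abcK abc'K (supp_in Xx) _ _;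
    by rewrite (supp_coord _ Xx).
exists O, D; split.
- by apply: openI; exact: open_coord_gt.
- by split; rewrite /= -(supp_coord _ Xm) sm ?finset.set21 ?finset.set22.
- exact: D_open.
exists (unbook a b c c'), (fun y : 'rV[R]_2 => book a b c c' (y 0 0) (y 0 ord_max)).
split.
- move=> x /[dup] Ox /XO xabc; rewrite /D /= /unbook pt0 pt1; case: Ox => Xx [/= xa xb].
  move: (unbookK u Xx xabc); set p := x 0 a - _; set q := x 0 c - _ => xpq.
  move: xa xb; rewrite -xpq book_a book_b// => xa xb.
  by rewrite -ltrBrDr ltr_norml; apply/andP; split; lra.
- move=> y yD.
  by have [Xy ya yb _] := book_realization u Ksub abcK abc'K yD.
- move=> x; rewrite inE => /[dup] [[Xx _]] /XO xabc.
  by rewrite /unbook pt0 pt1 (unbookK u Xx xabc).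
- by move=> y _; rewrite bookK// -pt_eta.
- split; apply: continuous_subspaceT; first exact: unbook_continuous.
  exact: book_coord_continuous.
Qed.

End SurfaceEdges.

(** * Chains and coloured strips *)

Section AlternatingSign.
Variable T : finType.
Implicit Types (A : {set T}) (d e x : T).

(* The union of a perfect matching s and a partial matching r (whose unmatched
   points are its fixed points) is bipartite: contract an edge of r. *)
Lemma matchings_bipartite A (s r : T -> T) :
  (forall x, x \in A -> [/\ s x \in A, s (s x) = x & s x != x]) ->
  (forall x, x \in A -> r x \in A /\ r (r x) = x) ->
  exists f : T -> bool, forall x, x \in A ->
    f (s x) = ~~ f x /\ (r x != x -> f (r x) = ~~ f x).
Proof.
have [m] := ubnP #|A|; elim: m A s r => // m IH A s r Am sA rA.
(* When [r] fixes all of [A], only the pairs of [s] matter, and comparing ranks separates the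
   members of each. *)
have [[d dA rd]|rfix] := pselect (exists2 d, d \in A & r d != d); last first.
  exists (fun x => enum_rank x < enum_rank (s x))%N => x xA; split; last first.
    by move=> rx; case: rfix; exists x.
  have [_ -> sx] := sA x xA.
  have : enum_rank (s x) != enum_rank x :> nat.
    by rewrite (inj_eq val_inj) (inj_eq enum_rank_inj).
  by case: ltngtP.
pose e := r d; have [eA re] := rA d dA.
have [sdA ssd sd] := sA d dA; have [seA sse se] := sA e eA.
pose s' x := if x == s d then s e else if x == s e then s d else s x.
have inA' x : (x \in A :\ d :\ e) = [&& x != e, x != d & x \in A].
  by rewrite !in_setD1.
have sdse : s d != s e.
  by apply: contraNneq rd => h; rewrite -/e -sse -h ssd.
have [|x|x|f' f'P] := IH (A :\ d :\ e)%SET s' r.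
- move: Am; rewrite (cardsD1 d) dA (cardsD1 e) in_setD1 rd eA.
  by rewrite !add1n !ltnS => /ltnW.
- rewrite inA' => /and3P[xe xd xA]; have [sxA ssx sx] := sA x xA.
  rewrite /s'; have [xsd|xsd] := eqVneq x (s d).
    have sde : s d != e by rewrite -xsd.
    rewrite inA' seA se xsd [s e == s d]eq_sym (negbTE sdse) eqxx /= andbT.
    by split=> //; apply: contra_neq sde => h; rewrite -h sse.
  have [xse|xse] := eqVneq x (s e).
    have sed : s e != d by rewrite -xse.
    rewrite inA' sdA sd xse eqxx /= !andbT; split=> //.
    by apply: contra_neq sed => h; rewrite -h ssd.
  have sxd : s x != d by apply: contraNneq xsd => <-; rewrite ssx.
  have sxe : s x != e by apply: contraNneq xse => <-; rewrite ssx.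
  rewrite inA' sxe sxd sxA; split=> //.
  have [h|_] := eqVneq (s x) (s d); first by move: xd; rewrite -ssx h ssd eqxx.
  have [h|//] := eqVneq (s x) (s e); by move: xe; rewrite -ssx h sse eqxx.
- rewrite inA' => /and3P[xe xd xA]; have [rxA rrx] := rA x xA.
  rewrite inA' rxA andbT; split=> //; apply/andP; split.
    by apply: contraNneq xd => h; rewrite -rrx h /e re.
  by apply: contraNneq xe => h; rewrite -rrx h.
(* If [s] matches [d] with [e], they form a whole component and [b] is arbitrary; otherwise [e]
   takes the value of [s d], and [d] the opposite one. *)
pose b := if s d == e then false else f' (s d).
exists (fun x => if x == d then ~~ b else if x == e then b else f' x) => x xA.
have ed : e != d by [].
have [->|xd] := eqVneq x d.
  rewrite (negbTE sd) -/e (negbTE ed) eqxx negbK; split=> //.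
  by rewrite /b; case: eqP.
have [->|xe] := eqVneq x e.
  rewrite re eqxx (negbTE se); split=> //.
  have [sed|sed] := eqVneq (s e) d => //.
  have sde : s d != e by apply: contra_neq sed => h; rewrite -h ssd.
  have [|+ _] := f'P (s d); first by rewrite inA' sde sd.
  by rewrite /s' eqxx /b (negbTE sde).
have xA' : x \in (A :\ d :\ e)%SET by rewrite inA' xe xd.
have [sx' rx'] := f'P x xA'; have [sxA ssx sx] := sA x xA; have [rxA rrx] := rA x xA.
split; last first.
  move=> /rx' <-; rewrite ifN; last by apply: contraNneq xe => h; rewrite -rrx h.
  by rewrite ifN//; apply: contraNneq xd => h; rewrite -rrx h /e re.
have [sxd|sxd] := eqVneq (s x) d.
  have xsd : x = s d by rewrite -sxd ssx.
  by rewrite /b -xsd (negbTE xe).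
have [sxe|sxe] := eqVneq (s x) e.
  have xse : x = s e by rewrite -sxe ssx.
  have sed : s e != d by rewrite -xse.
  have sde : s d != e by apply: contra_neq sed => h; rewrite -h ssd.
  have [|+ _] := f'P (s d); first by rewrite inA' sde sd.
  by rewrite /s' eqxx /b (negbTE sde) xse => ->; rewrite negbK.
move: sx'; rewrite /s'; case: eqP => [h|_]; first by rewrite h ssd eqxx in sxd.
case: eqP => [h|//]; by rewrite h sse eqxx in sxe.
Qed.

End AlternatingSign.

(** * Simplicial chains and relative homology *)

Section Chains.
Variables (F : fieldType) (n : nat).
Implicit Types (K A : {set {set 'I_n}}) (c : chain F n) (t : {set 'I_n}).

Lemma chainsP K m c :
  reflect (forall t, c t != 0 -> t \in K /\ #|t| = m) (c \in chains F K m).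
Proof.
apply: (iffP idP) => [cK t|cK].
  pose X := [seq ([ffun t' => (t' == s)%:R] : chain F n) |
    s <- enum [set s in K | #|s| == m]%SET].
  have cX : c \in <<in_tuple X>>%VS by [].
  rewrite (coord_span cX) sum_ffunE.
  apply: contraPP => tK; apply/negP; rewrite negbK; apply/eqP.
  rewrite big1// => i _; rewrite ffunE.
  have /mapP[s] : X`_i \in X by rewrite mem_nth.
  rewrite mem_enum inE => /andP[sK /eqP sm] ->.
  rewrite ffunE; case: eqP => [ts|_]; last by rewrite scaler0.
  by case: tK; rewrite ts.
have -> : c = \sum_(t in [set s in K | #|s| == m]%SET)
    c t *: ([ffun t' => (t' == t)%:R] : chain F n).
  apply/ffunP => t; rewrite sum_ffunE.
  have [tK|tK] := boolP (t \in [set s in K | #|s| == m]%SET).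
    rewrite (bigD1 t)//= !ffunE eqxx -[_ *: _]/(c t * 1) mulr1.
    rewrite big1 ?addr0// => s /andP[_ st].
    by rewrite !ffunE eq_sym (negbTE st) scaler0.
  rewrite big1 => [|s sK]; last first.
    rewrite !ffunE; case: eqP => [ts|_]; last by rewrite scaler0.
    by rewrite ts sK in tK.
  apply/eqP; apply: contraNT tK => /cK[tK tm]; by rewrite inE tK tm eqxx.
apply: rpred_sum => t tK; apply: rpredZ; apply: memv_span.
by apply/mapP; exists t; rewrite ?mem_enum.
Qed.

Definition sign (i : 'I_n) t : F := (-1) ^+ #|[set j in t | (j < i)%N]|%SET.

Lemma boundary_funE c t :
  boundary_fun c t = \sum_(i | i \notin t) sign i t * c (i |: t)%SET.
Proof. by rewrite ffunE. Qed.

Lemma sign_neq0 i t : sign i t != 0.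
Proof. by rewrite /sign signr_eq0. Qed.

Lemma signU i j t : i \notin t -> j != i ->
  sign j (i |: t)%SET = (-1) ^+ (i < j)%N * sign j t.
Proof.
move=> it ji; rewrite /sign -exprD.
have [ij|ij] := boolP (i < j)%N.
  rewrite (_ : [set k in _ | _] = i |: [set k in t | (k < j)%N])%SET.
    by rewrite cardsU1 inE (negbTE it).
  by apply/finset.setP => k; rewrite !inE; case: eqP => //= ->; rewrite ij.
congr (_ ^+ _); apply: eq_card => k; rewrite !inE.
by case: eqP => //= ->; rewrite (negbTE ij) (negbTE it).
Qed.

(** The terms that add [i] and [j] in the two orders cancel, since inserting the smaller vertex
    shifts the position of the larger one, but not conversely. *)
Lemma boundary_boundary c : boundary_fun (boundary_fun c) = 0.
Proof.
apply/ffunP => t; rewrite boundary_funE ffunE.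
pose G i j := sign i t * (sign j (i |: t)%SET * c (j |: (i |: t))%SET).
have GN i j : i \notin t -> j \notin t -> i != j -> G j i = - G i j.
  move=> it jt ij; rewrite /G !signU// 1?eq_sym// finset.setUCA.
  have -> : (-1) ^+ (j < i)%N = - (-1) ^+ (i < j)%N :> F.
    by case: (ltngtP i j) => [||/val_inj/eqP]; rewrite ?(negbTE ij)// ?opprK.
  ring.
have E i : i \notin t -> sign i t * boundary_fun c (i |: t)%SET =
    \sum_(j | (j \notin t) && (i < j)%N) G i j
    + \sum_(j | (j \notin t) && (j < i)%N) G i j.
  move=> it; rewrite boundary_funE mulr_sumr.
  rewrite (bigID (fun j : 'I_n => (i < j)%N))/=; congr (_ + _); apply: eq_bigl => j;
    rewrite !inE negb_or -andbA.
    by case: eqP => [->|_]; rewrite ?ltnn ?andbF.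
  rewrite -leqNgt leq_eqVlt; case: eqP => [->|/eqP ji].
    by rewrite ltnn andbF.
  by rewrite (inj_eq val_inj) (negbTE ji).
rewrite (eq_bigr _ E) big_split/= [X in _ + X](exchange_big_dep (fun i => i \notin t))/=;
  last by move=> i j _ /andP[].
rewrite -big_split/= big1// => i it.
rewrite [X in _ + X](eq_big (fun j => (j \notin t) && (i < j)%N) (fun j => - G i j)).
- by rewrite sumrN subrr.
- by move=> j; rewrite it.
- by move=> j /andP[jt /andP[_ ij]]; rewrite GN// neq_ltn ij.
Qed.

Lemma card_set3 (a b c : 'I_n) : uniq [:: a; b; c] -> #|[set a; b; c]|%SET = 3%N.
Proof.
rewrite /= !inE negb_or andbT => /andP[/andP[ab ac] bc].
by rewrite -finset.setUA cardsU1 cards2 !inE negb_or ab ac bc.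
Qed.

(** The complement representing the quotient is zero exactly when all relative cycles are relative
    boundaries. *)
Lemma rel_homology0P K A k : rel_homology F K A k = 0%VS ->
  forall c, c \in chains F K k.+1 -> boundary_fun c \in chains F A k ->
  exists s b, [/\ s \in chains F K k.+2, b \in chains F A k.+1
    & c = boundary_fun s + b].
Proof.
move=> /eqP; rewrite /rel_homology diffv_eq0 => /subvP KA c cK cA.
have /memv_addP[u /memv_imgP[s sK ->] [b bA ->]] : c \in rel_boundaries F K A k.
  by apply: KA; rewrite memv_cap cK -memv_preim lfunE.
by exists s, b; rewrite lfunE.
Qed.

End Chains.

(** * The colouring argument, from combinatorial properties of surfaces *)

Section NoRainbow.
Variables (F : fieldType) (n : nat) (K Bd : {set {set 'I_n}}).
Variable V : 'I_3 -> {set 'I_n}.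
Implicit Types (t : {set 'I_n}) (a b c u v w x y : 'I_n) (p : chain F n).

Hypothesis Ksub : simplicial_complex K.
Hypothesis pure : forall a b, a != b -> [set a; b]%SET \in K ->
  exists2 c, c \notin [set a; b]%SET & [set a; b; c]%SET \in K.
Hypothesis two_cofaces : forall a b c c' d, uniq [:: a; b; c; c'] ->
  [set a; b; c]%SET \in K -> [set a; b; c']%SET \in K ->
  d \notin [set a; b]%SET -> [set a; b; d]%SET \in K -> d = c \/ d = c'.
Hypothesis boundary_vertex : forall a b c, uniq [:: a; b; c] ->
  [set a; b; c]%SET \in K ->
  (forall d, d \notin [set a; b]%SET -> [set a; b; d]%SET \in K -> d = c) ->
  [set a]%SET \in Bd.
Hypothesis interior_edge : forall a b c c', uniq [:: a; b; c; c'] ->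
  [set a; b; c]%SET \in K -> [set a; b; c']%SET \in K -> [set a; b]%SET \notin Bd.
Hypothesis link : forall v w0 w (P : {set 'I_n}), w0 != v -> w != v ->
  [set v; w0]%SET \in K -> [set v; w]%SET \in K ->
  (forall a b, a != v -> b != v -> [set v; a; b]%SET \in K -> a \in P -> b \in P) ->
  w0 \in P -> w \in P.
Hypothesis disjV : forall i j v, v \in V i -> v \in V j -> i = j.
Hypothesis coverV : forall v, [set v]%SET \in K -> exists i, v \in V i.
Hypothesis no_rainbow : forall i j k a b c, uniq [:: i; j; k] ->
  a \in V i -> b \in V j -> c \in V k -> [set a; b; c]%SET \notin K.

Lemma uniq3 a b c : (c \notin [set a; b]%SET) && (a != b) = uniq [:: a; b; c].
Proof.
by rewrite /= !inE !negb_or andbT [c == a]eq_sym [c == b]eq_sym; do 3 case: eqP.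
Qed.

Lemma uniq3E (T : eqType) (a b c : T) : uniq [:: a; b; c] ->
  [/\ a != b, a != c & b != c].
Proof. by rewrite /= !inE negb_or andbT => /andP[/andP[]]. Qed.

Lemma uniq4 a b c c' : uniq [:: a; b; c] -> uniq [:: a; b; c'] -> c' != c ->
  uniq [:: a; b; c; c'].
Proof.
rewrite /= !inE !negb_or !andbT => /andP[/andP[-> ->] ->] /andP[/andP[_ ->] ->].
by rewrite eq_sym => ->.
Qed.

Lemma coface_edge u a b : (u |: [set a; b])%SET = [set a; b; u]%SET.
Proof. by rewrite finset.setUC. Qed.

Lemma boundary_fun_neq0 p t : boundary_fun p t != 0 ->
  exists2 u, u \notin t & p (u |: t)%SET != 0.
Proof.
rewrite boundary_funE => h; apply: contrapT => h'; move/eqP: h; apply.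
rewrite big1// => u ut; apply/eqP; rewrite mulf_eq0; apply/orP; right.
by apply: contra_notT h' => pu; exists u.
Qed.

Lemma boundary_edge p a b c c' : uniq [:: a; b; c; c'] ->
  [set a; b; c]%SET \in K -> [set a; b; c']%SET \in K ->
  (forall t, p t != 0 -> t \in K) ->
  boundary_fun p [set a; b]%SET =
  sign F c [set a; b]%SET * p [set a; b; c]%SET
  + sign F c' [set a; b]%SET * p [set a; b; c']%SET.
Proof.
move=> abcc' abcK abc'K pK; rewrite boundary_funE.
move: (abcc'); rewrite /= !inE !negb_or => /and4P[/and3P[ab ac ac'] /andP[bc bc'] cc' _].
rewrite (bigD1 c) ?inE ?negb_or ?[c == _]eq_sym ?ac ?bc//= coface_edge.
rewrite (bigD1 c') ?inE ?negb_or ?[c' == _]eq_sym ?ac' ?bc' ?cc'//= coface_edge.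
rewrite big1 ?addr0// => d /andP[/andP[dab dc] dc'].
apply/eqP; rewrite mulf_eq0; apply/orP; right; rewrite coface_edge.
apply/negPn/negP => /pK dK.
by case: (two_cofaces abcc' abcK abc'K dab dK) => /eqP; apply/negP.
Qed.

Lemma sign_edge a b c : a != b ->
  sign F c [set a; b]%SET = (-1) ^+ ((a < c)%N (+) (b < c)%N).
Proof.
move=> ab; rewrite signr_addb -exprD /sign; congr (_ ^+ _).
rewrite -sum1_card (eq_bigl (fun j => (j \in [set a; b]%SET) && (j < c)%N)).
  rewrite big_mkcondr/= big_setU1 ?inE//= big_set1.
  by do 2 case: ifP.
by move=> j; rewrite inE.
Qed.

(** * Strips of triangles in two colours *)

Section Strip.
Variables i j : 'I_3.
Hypothesis ij : i != j.

Definition face (d : 'I_n * 'I_n * 'I_n) : {set 'I_n} := [set d.1.1; d.1.2; d.2]%SET.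

(* The darts of the strip of triangles coloured by i and j: (x, y, u) stands
   for the triangle {x, y, u} seen from its bicoloured edge {x, y}. *)
Definition dart : {set 'I_n * 'I_n * 'I_n} :=
  [set d | [&& d.1.1 \in V i, d.1.2 \in V j, d.2 \in V i :|: V j,
    d.2 \notin [set d.1.1; d.1.2] & face d \in K]]%SET.

Lemma dartP x y u : reflect [/\ x \in V i, y \in V j, u \in (V i :|: V j)%SET,
   uniq [:: x; y; u] & [set x; y; u]%SET \in K] ((x, y, u) \in dart).
Proof.
rewrite [_ \in dart]inE; apply: (iffP and5P) => -[xi yj uij xyu xyuK]; split=> //.
  rewrite -uniq3 xyu; apply: contraNneq ij => xy.
  by apply/eqP; apply: disjV xi _; rewrite xy.
by move: xyu; rewrite -uniq3 => /andP[].
Qed.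

(** The third vertex has some colour, and one other than [i] and [j] would make the triangle
    rainbow. *)
Lemma edge_dart x y u : x \in V i -> y \in V j -> uniq [:: x; y; u] ->
  [set x; y; u]%SET \in K -> (x, y, u) \in dart.
Proof.
move=> xi yj xyu xyuK; apply/dartP; split=> //.
have [|k uk] := coverV (v := u).
  by apply: Ksub xyuK _; rewrite finset.subsetUr.
rewrite inE; apply/orP; have [<-|ki] := eqVneq k i; first by left.
have [<-|kj] := eqVneq k j; first by right.
have ijk : uniq [:: i; j; k].
  by rewrite /= !inE negb_or ij ![_ == k]eq_sym ki kj.
by have := no_rainbow ijk xi yj uk; rewrite xyuK.
Qed.

(** The same triangle seen from its other bicoloured edge, which depends on the colour of the third
    vertex. *)
Definition across_triangle (d : 'I_n * 'I_n * 'I_n) :=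
  if d.2 \in V i then (d.2, d.1.2, d.1.1) else (d.1.1, d.2, d.1.2).

(** The other triangle at the same edge. A dart whose edge lies in a single triangle is fixed: it is
    an end of a strip. *)
Definition across_edge (d : 'I_n * 'I_n * 'I_n) :=
  (d.1, odflt d.2 [pick w | [&& w != d.2, w \notin [set d.1.1; d.1.2]%SET
                              & [set d.1.1; d.1.2; w]%SET \in K]]).

Lemma notV v : v \in V j -> (v \in V i) = false.
Proof.
by move=> vj; apply/negP => vi; move/negP: ij; apply; rewrite (disjV vi vj).
Qed.

Lemma across_triangleP d : d \in dart ->
  [/\ across_triangle d \in dart, across_triangle (across_triangle d) = d
    & across_triangle d != d].
Proof.
case: d => [[x y] u] /dartP[xi yj]; rewrite inE => uij xyu xyuK.
have [xy xu yu] := uniq3E xyu.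
rewrite /across_triangle /=; case: ifP uij => /= [ui _|ui uj].
  rewrite xi; split=> //; last by apply: contra_neq xu => -[_ ->].
  apply: edge_dart => //.
    by rewrite /= !inE !negb_or ![u == _]eq_sym [y == x]eq_sym yu xu xy.
  rewrite (_ : [set u; y; x] = [set x; y; u])%SET//.
  by apply/finset.setP => z; rewrite !inE; case: (z == u); case: (z == y); case: (z == x).
rewrite (notV yj); split=> //; last by apply: contra_neq yu => -[_ ->].
apply: edge_dart => //; last by rewrite finset.setUAC.
by rewrite /= !inE !negb_or [u == y]eq_sym yu xu xy.
Qed.

Lemma across_edgeE x y c c' : uniq [:: x; y; c; c'] ->
  [set x; y; c]%SET \in K -> [set x; y; c']%SET \in K ->
  across_edge (x, y, c) = (x, y, c').
Proof.
move=> xycc' cK c'K; rewrite /across_edge /=; congr pair.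
case: pickP => [w /and3P[wc wxy wK]|/(_ c')] /=.
  by case: (two_cofaces xycc' cK c'K wxy wK) wc => ->; rewrite ?eqxx.
rewrite c'K andbT; move: xycc'; rewrite /= !inE !negb_or.
move=> /and4P[/and3P[_ _ xc'] /andP[_ yc'] cc' _].
by rewrite ![c' == _]eq_sym xc' yc' cc'.
Qed.

Lemma across_edgeP d : d \in dart ->
  across_edge d \in dart /\ across_edge (across_edge d) = d.
Proof.
case: d => [[x y] c] cD; have /dartP[xi yj cij xyc cK] := cD.
have [[c' [c'c c'xy c'K]]|alone] := pselect (exists c',
  [/\ c' != c, c' \notin [set x; y]%SET & [set x; y; c']%SET \in K]).
  have xyc' : uniq [:: x; y; c'].
    by move: xyc; rewrite -!uniq3 c'xy => /andP[].
  rewrite (across_edgeE (c' := c'))//; last exact: uniq4.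
  rewrite (across_edgeE (c' := c))//; last by apply: uniq4 => //; rewrite eq_sym.
  by split=> //; exact: edge_dart.
have -> : across_edge (x, y, c) = (x, y, c); last first.
  split=> //; rewrite /across_edge /=; congr pair; case: pickP => //= w.
  by move=> /and3P[wc wxy wK]; case: alone; exists w.
rewrite /across_edge /=; congr pair; case: pickP => //= w /and3P[wc wxy wK].
by case: alone; exists w.
Qed.

(** A coefficient read off a dart is thus well defined on triangles once [across_triangle] preserves
    it. *)
Lemma face_dart d d' : d \in dart -> d' \in dart -> face d = face d' ->
  d' = d \/ d' = across_triangle d.
Proof.
case: d d' => [[x y] u] [[x' y'] u'] /dartP[xi yj uij xyu _].
move=> /dartP[x'i y'j u'ij xyu' _]; rewrite /face /= => E.
have xE : x' \in [set x; y; u]%SET by rewrite E !inE eqxx.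
have yE : y' \in [set x; y; u]%SET by rewrite E !inE eqxx orbT.
have uE : u' \in [set x; y; u]%SET by rewrite E !inE eqxx orbT.
have [xy xu yu] := uniq3E xyu; have [xy' xu' yu'] := uniq3E xyu'.
have x'y : x' != y by apply: contraTneq x'i => ->; rewrite (notV yj).
have y'x : y' != x by apply: contraTneq y'j => ->; apply/negP => /notV; rewrite xi.
rewrite /across_triangle /=.
move: xE yE uE; rewrite !inE (negbTE x'y) (negbTE y'x) orbF /=.
move=> xE yE uE; move: uij; rewrite inE; case: ifP => /= [ui _|ui uj].
  have {}yE : y' = y.
    case/orP: yE => /eqP // yu''; move: y'j; rewrite yu'' => /notV.
    by rewrite ui.
  rewrite yE in yu' *; move: uE; rewrite [u' == y]eq_sym (negbTE yu') orbF.
  move: xu'; case/orP: xE => /eqP ->; rewrite eq_sym => /negbTE -> /=.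
    by move=> /eqP ->; left.
  by rewrite orbF => /eqP ->; right.
have {}xE : x' = x.
  by case/orP: xE => /eqP // xu''; move: x'i; rewrite xu'' ui.
rewrite xE in xu' *; move: uE; rewrite [u' == x]eq_sym (negbTE xu') /=.
move: yu'; case/orP: yE => /eqP ->; rewrite eq_sym => /negbTE -> /=.
  by move=> /eqP ->; left.
by rewrite orbF => /eqP ->; right.
Qed.

(** The sign [f] alternates along both matchings: across a triangle this makes its two darts agree
    on the coefficient, and across an interior bicoloured edge it makes the two contributions to the
    boundary cancel. *)
Lemma strip_exists : exists p : chain F n,
  [/\ forall t, p t != 0 -> exists2 d, d \in dart & face d = t,
      forall d, d \in dart -> p (face d) != 0
    & forall x y c c', x \in V i -> y \in V j -> uniq [:: x; y; c; c'] ->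
      [set x; y; c]%SET \in K -> [set x; y; c']%SET \in K ->
      boundary_fun p [set x; y]%SET = 0].
Proof.
have [f fP] := matchings_bipartite across_triangleP across_edgeP.
(* The exponent of the coefficient of the face of d for which the edge oriented
   from its vertex of colour i to that of colour j gets the sign f d. *)
pose wt (d : 'I_n * 'I_n * 'I_n) := f d (+) (d.1.2 < d.1.1)%N (+) (d.1.1 < d.2)%N
  (+) (d.1.2 < d.2)%N.
have wt_across d : d \in dart -> wt (across_triangle d) = wt d.
  move=> dD; have [fd _] := fP d dD; rewrite /wt fd.
  case: d dD {fd} => [[x y] u] /dartP[xi yj uij xyu _].
  have ltC (a b : 'I_n) : a != b -> (b < a)%N = ~~ (a < b)%N.
    by move=> ab; case: ltngtP => // /val_inj/eqP; rewrite eq_sym (negbTE ab).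
  have [xy xu yu] := uniq3E xyu; rewrite /across_triangle /=; case: ifP => _ /=.
    rewrite (ltC x u)//; case: (f _); case: (y < u)%N; case: (x < u)%N;
      by case: (y < x)%N.
  rewrite (ltC x u)// (ltC x y)// (ltC y u)//; case: (f _); case: (y < u)%N;
    by case: (x < u)%N; case: (x < y)%N.
pose p : chain F n := [ffun t =>
  if [pick d in dart | face d == t] is Some d then (-1) ^+ wt d else 0].
have pface d : d \in dart -> p (face d) = (-1) ^+ wt d.
  move=> dD; rewrite ffunE; case: pickP => [d'|/(_ d)]; last by rewrite dD eqxx.
  move=> /andP[d'D /eqP dd']; congr (_ ^+ _).
  by case: (face_dart dD d'D (esym dd')) => ->//; rewrite wt_across.
have psupp t : p t != 0 -> exists2 d, d \in dart & face d = t.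
  rewrite ffunE; case: pickP => [d /andP[dD /eqP dt] _|_]; first by exists d.
  by rewrite eqxx.
exists p; split=> // [d dD|x y c c' xi yj xycc' cK c'K].
  by rewrite pface// signr_eq0.
have pK t : p t != 0 -> t \in K.
  by move=> /psupp[[[x' y'] u] /dartP[_ _ _ _ tK] <-].
have /andP[xyc xyc'] : uniq [:: x; y; c] && uniq [:: x; y; c'].
  by move: xycc'; rewrite /= !inE !negb_or !andbT =>
    /and3P[/and3P[-> -> ->] /andP[-> ->] _].
have cD := edge_dart xi yj xyc cK; have c'D := edge_dart xi yj xyc' c'K.
have xy : x != y by move: xyc; rewrite -uniq3 => /andP[].
rewrite (boundary_edge xycc' cK c'K pK) !sign_edge//.
rewrite -[X in p X]/(face (x, y, c)) -[X in _ + _ * p X]/(face (x, y, c')) !pface//.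
rewrite /wt /= -!signr_addb.
have [_] := fP _ cD; rewrite (across_edgeE xycc' cK c'K) => ->; last first.
  apply: contraTneq xycc' => -[->]; by rewrite /= !inE eqxx !andbF.
case: (f _); case: (y < x)%N; case: (x < c)%N; case: (y < c)%N;
  case: (x < c')%N; case: (y < c')%N; rewrite /= ?expr0 ?expr1; ring.
Qed.

End Strip.

(** * Propagation around vertices and along a colour class *)

Lemma boundary_fun_sub p q : boundary_fun (p - q) = boundary_fun p - boundary_fun q.
Proof. exact: raddfB. Qed.

(** At an edge with two triangles the vanishing boundary is a sum of two signed coefficients, so
    these are nonzero together. *)
Lemma edge_coface_propagate (p : chain F n) v u c c' :
  (forall t, p t != 0 -> t \in K) ->
  (forall c c', uniq [:: v; u; c; c'] -> [set v; u; c]%SET \in K ->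
     [set v; u; c']%SET \in K -> boundary_fun p [set v; u]%SET = 0) ->
  uniq [:: v; u; c] -> [set v; u; c]%SET \in K ->
  uniq [:: v; u; c'] -> [set v; u; c']%SET \in K ->
  p [set v; u; c]%SET != 0 -> p [set v; u; c']%SET != 0.
Proof.
move=> pK bp vuc cK vuc' c'K pc; have [->//|c'c] := eqVneq c' c.
have vucc' := uniq4 vuc vuc' c'c.
have := bp _ _ vucc' cK c'K; rewrite (boundary_edge vucc' cK c'K pK).
apply: contra_eq_neq => ->; rewrite mulr0 addr0.
by rewrite mulf_neq0// sign_neq0.
Qed.

Lemma uniq3_rot a b c : uniq [:: a; b; c] -> uniq [:: a; c; b].
Proof.
move=> /uniq3E[ab ac bc].
by rewrite /= !inE negb_or ac ab [c == b]eq_sym bc.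
Qed.

Lemma uniq3_notin a b c : a != b -> c \notin [set a; b]%SET -> uniq [:: a; b; c].
Proof. by move=> ab cab; rewrite -uniq3 cab. Qed.

Lemma edgeK a b c : [set a; b; c]%SET \in K -> [set a; b]%SET \in K.
Proof. by move=> abcK; apply: Ksub abcK _; rewrite finset.subsetUl. Qed.

Lemma star_propagate (p : chain F n) v :
  (forall t, p t != 0 -> t \in K) ->
  (forall u c c', uniq [:: v; u; c; c'] -> [set v; u; c]%SET \in K ->
     [set v; u; c']%SET \in K -> boundary_fun p [set v; u]%SET = 0) ->
  forall a b, uniq [:: v; a; b] -> p [set v; a; b]%SET != 0 ->
  forall c d, uniq [:: v; c; d] -> [set v; c; d]%SET \in K ->
  p [set v; c; d]%SET != 0.
Proof.
move=> pK bp a b vab pab c d vcd cdK; have abK := pK _ pab.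
(* [P] collects the [w] for which every triangle at the edge from [v] to [w] has a nonzero
   coefficient; a triangle [{v, x, y}] passes this property from [x] to [y]. *)
pose P : {set 'I_n} := [set w | `[< forall e, uniq [:: v; w; e] ->
  [set v; w; e]%SET \in K -> p [set v; w; e]%SET != 0 >]]%SET.
have [va vb _] := uniq3E vab; have [vc _ _] := uniq3E vcd.
suff : c \in P by rewrite inE => /asboolP; exact.
apply: (link (v := v) (w0 := a)).
- by rewrite eq_sym.
- by rewrite eq_sym.
- exact: edgeK abK.
- exact: edgeK cdK.
- move=> x y xv yv xyK xP; have [<-//|xy] := eqVneq x y.
  have vxy : uniq [:: v; x; y].
    by rewrite /= !inE negb_or ![v == _]eq_sym xv yv xy.
  move: xP; rewrite inE => /asboolP/(_ y vxy xyK) pxy.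
  rewrite inE; apply/asboolP => e vye eK.
  apply: (edge_coface_propagate (c := x)) => //.
  + exact: bp.
  + exact: uniq3_rot.
  + by rewrite finset.setUAC.
  + by rewrite finset.setUAC.
- rewrite inE; apply/asboolP => e vae eK.
  exact: (edge_coface_propagate (c := b)) (bp a) vab abK vae eK pab.
Qed.

Hypothesis acyclic : forall i, rel_homology F (induced K (V i))
  (induced K (V i) :&: Bd)%SET 1 = 0%VS.

Lemma face_colours i j d : i != j -> d \in dart i j ->
  [/\ face d \in K, #|face d| = 3%N, face d \subset (V i :|: V j)%SET,
      exists2 x, x \in face d & x \in V i & exists2 y, y \in face d & y \in V j].
Proof.
move=> ij; case: d => [[x y] u] /(dartP ij)[xi yj uij xyu xyuK]; split=> //.
- exact: card_set3.
- apply/fintype.subsetP => z; rewrite !inE => /orP[/orP[]|] /eqP->; last first.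
  + by move: uij; rewrite inE.
  + by rewrite yj orbT.
  + by rewrite xi.
- by exists x => //; rewrite !inE eqxx.
- by exists y => //; rewrite !inE eqxx orbT.
Qed.

(* All triangles around a component of the vertices coloured i carry nonzero
   coefficients of one chain, or all zero ones; hence the component sees only
   one other colour. *)
Lemma colour_seen i j : i != j -> exists Z : 'I_n -> bool,
  [/\ forall v u, v \in V i -> u \in V i -> [set v; u]%SET \in K -> Z v -> Z u,
      forall v u, v \in V i -> u \in V j -> [set v; u]%SET \in K -> Z v
    & forall v u k, v \in V i -> u \in V k -> uniq [:: i; j; k] ->
      [set v; u]%SET \in K -> ~~ Z v].
Proof.
move=> ij; have [p [psupp pface bp]] := strip_exists ij.
have pK t : p t != 0 -> t \in K by move=> /psupp[d /(face_colours ij)[dK _ _ _ _] <-].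
pose w : chain F n :=
  [ffun t : {set 'I_n} => if t \subset V i then boundary_fun p t else 0].
have wK : w \in chains F (induced K (V i)) 2.
  apply/chainsP => t; rewrite ffunE; case: ifP => [ti|_]; last by rewrite eqxx.
  move=> /boundary_fun_neq0[u ut /psupp[d /(face_colours ij)[dK d3 _ _ _] dE]].
  split; last by move: d3; rewrite dE cardsU1 ut => -[].
  by rewrite inE ti andbT; apply: Ksub dK _; rewrite dE finset.subsetUr.
have bp_other v u : v \in V i -> u \notin V i -> v != u ->
    boundary_fun p [set v; u]%SET != 0 -> [set v]%SET \in Bd.
  move=> vi ui vu /[dup] bpn0 /boundary_fun_neq0[c cvu].
  rewrite coface_edge => pc; have cK := pK _ pc.
  have uj : u \in V j.
    have [d /(face_colours ij)[_ _ /fintype.subsetP dij _ _] dE] := psupp _ pc.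
    have := dij u; rewrite dE !inE eqxx orbT /= (negbTE ui) /=; exact.
  have vuc := uniq3_notin vu cvu.
  apply: (boundary_vertex vuc cK) => d dvu dK; apply: contrapT => /eqP dc.
  have vud := uniq3_notin vu dvu.
  by move/eqP: bpn0; apply; apply: (bp v u c d) => //; exact: uniq4 vuc vud dc.
have bwK : boundary_fun w \in chains F (induced K (V i) :&: Bd)%SET 1.
  apply/chainsP => t /[dup] bw0 /boundary_fun_neq0[u ut].
  have /chainsP wP := wK; move=> /wP[]; rewrite cardsU1 ut => utK [t1].
  split=> //; move: bw0; have /cards1P[v tv] := introT eqP t1; rewrite tv in ut utK *.
  move: utK; rewrite inE => /andP[uvK /fintype.subsetP uvi].
  have vi : v \in V i by apply: uvi; rewrite !inE eqxx orbT.
  apply: contraNT; rewrite inE negb_and => vB.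
  have {}vB : [set v]%SET \notin Bd.
    move: vB; rewrite inE finset.sub1set vi andbT => /orP[|//].
    by rewrite (Ksub uvK)// finset.subsetUr.
  (* As [v] is off the boundary of the surface, the edges leaving [V i] contribute nothing, by
     [bp_other]; so [w] and the boundary of [p] have the same boundary at [v], namely 0. *)
  have : boundary_fun (boundary_fun p) [set v]%SET = 0.
    by rewrite boundary_boundary ffunE.
  rewrite !boundary_funE => {2}<-; apply/eqP; apply: eq_bigr => x xv; congr (_ * _).
  rewrite ffunE; case: ifP => // /negbT xvi; apply/esym/eqP.
  apply: contraNT vB; rewrite finset.setUC; apply: bp_other => //.
    apply: contraNN xvi => xi; apply/fintype.subsetP => z.
    by rewrite !inE => /orP[]/eqP->.
  by move: xv; rewrite inE eq_sym.
have [s [r [sK rB wE]]] := rel_homology0P (acyclic i) wK bwK.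
move/chainsP: sK => sP; move/chainsP: rB => rP.
have sV t : s t != 0 -> t \in K /\ t \subset V i.
  by move=> /sP[]; rewrite inE => /andP[].
pose q := p - s.
have qE t : q t = p t - s t by rewrite !ffunE.
have qK t : q t != 0 -> t \in K.
  rewrite qE => qt; have [pt0|/pK//] := eqVneq (p t) 0.
  by move: qt; rewrite pt0 sub0r oppr_eq0 => /sV[].
have bq v u c c' : v \in V i -> uniq [:: v; u; c; c'] ->
    [set v; u; c]%SET \in K -> [set v; u; c']%SET \in K ->
    boundary_fun q [set v; u]%SET = 0.
  move=> vi vucc' cK c'K; rewrite /q boundary_fun_sub !ffunE -!boundary_funE.
  (* On an edge within [V i] the boundary of [q] is [r], which vanishes on interior edges. *)
  have [ui|ui] := boolP (u \in V i).
    have vui : [set v; u]%SET \subset V i.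
      by apply/fintype.subsetP => z; rewrite !inE => /orP[]/eqP->.
    have := congr1 (fun h : chain F n => h [set v; u]%SET) wE.
    rewrite ffunE vui => ->; rewrite [X in X - _]ffunE addrC addKr.
    apply/eqP; apply/negPn/negP => /rP[]; rewrite inE => /andP[_ vuB] _.
    by have := interior_edge vucc' cK c'K; rewrite vuB.
  (* Here no triangle of [s] contains [u], and if a triangle of [p] contains the edge, then [u] has
     colour [j] and [bp] applies. *)
  have -> : boundary_fun s [set v; u]%SET = 0.
    apply/eqP; apply/negPn/negP => /boundary_fun_neq0[x _ /sV[_ /fintype.subsetP xi]].
    by move/negP: ui; apply; apply: xi; rewrite !inE eqxx !orbT.
  rewrite subr0; apply/eqP; apply/negPn/negP => bpn0.
  have vu : v != u by move: vucc'; rewrite /= !inE !negb_or => /andP[/and3P[]].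
  have [x xvu] := boundary_fun_neq0 bpn0; rewrite coface_edge => px.
  have [d /(face_colours ij)[_ _ /fintype.subsetP dij _ _] dE] := psupp _ px.
  have uj : u \in V j.
    have := dij u; rewrite dE !inE eqxx orbT /= (negbTE ui) /=; exact.
  by move/eqP: bpn0; apply; exact: bp vucc' cK c'K.
(* By [star_propagate], one nonzero coefficient at a vertex of colour [i] forces all those around
   it. *)
pose Z v := `[< exists a b, uniq [:: v; a; b] /\ q [set v; a; b]%SET != 0 >].
have ZP v a b : v \in V i -> Z v -> uniq [:: v; a; b] -> [set v; a; b]%SET \in K ->
    q [set v; a; b]%SET != 0.
  move=> vi /asboolP[a' [b' [vab' qab']]] vab abK.
  by apply: star_propagate vab' qab' _ _ vab abK => // u c c'; exact: bq.
exists Z; split.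
- move=> v u vi ui vuK Zv; have [<-//|vu] := eqVneq v u.
  have [c cvu cK] := pure vu vuK; have vuc := uniq3_notin vu cvu.
  apply/asboolP; exists v, c; split.
    by move: vuc => /uniq3E[? ? ?]; rewrite /= !inE negb_or [u == v]eq_sym !andbT;
      apply/andP; split=> //; apply/andP.
  by rewrite [[set u; v]%SET]finset.setUC; exact: ZP.
- move=> v u vi uj vuK.
  have vu : v != u.
    by apply: contraNneq ij => vu; apply/eqP; apply: disjV vi _; rewrite vu.
  have [c cvu cK] := pure vu vuK; have vuc := uniq3_notin vu cvu.
  apply/asboolP; exists u, c; split=> //.
  have -> : q [set v; u; c]%SET = p [set v; u; c]%SET.
    rewrite qE (_ : s _ = 0) ?subr0//.
    apply/eqP; apply/negPn/negP => /sV[_ /fintype.subsetP/(_ u)].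
    by rewrite !inE eqxx orbT (notV ij uj) => /(_ isT).
  exact: (pface (v, u, c) (edge_dart ij vi uj vuc cK)).
- move=> v u k vi uk ijk vuK; apply/negP => Zv.
  have uV l : l != k -> u \notin V l.
    by apply: contraNN => ul; apply/eqP; exact: disjV ul uk.
  have [_ ik jk] := uniq3E ijk.
  have vu : v != u by apply: contraTneq vi => ->; exact: uV.
  have [c cvu cK] := pure vu vuK; have vuc := uniq3_notin vu cvu.
  (* A triangle with a vertex of the third colour is neither in the strip nor within [V i], so [q]
     is 0 on it. *)
  have := ZP v u c vi Zv vuc cK; rewrite qE (_ : p _ = 0); last first.
    apply/eqP; apply/negPn/negP => /psupp[d /(face_colours ij)[_ _ dij _ _] dE].
    move: dij; rewrite dE => /fintype.subsetP/(_ u).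
    by rewrite !inE eqxx orbT (negbTE (uV i ik)) (negbTE (uV j jk)) => /(_ isT).
  rewrite (_ : s _ = 0) ?subrr ?eqxx//.
  apply/eqP; apply/negPn/negP => /sV[_ /fintype.subsetP/(_ u)].
  by rewrite !inE eqxx orbT (negbTE (uV i ik)) => /(_ isT).
Qed.

End NoRainbow.

(** * The three colours in cyclic order, and the conclusion *)

Lemma ord3_cases (i j : 'I_3) : i != j -> j = i + 1 \/ j = i + 1 + 1.
Proof.
by case: i j => [[|[|[|//]]] ?] [[|[|[|//]]] ?] //= _;
  first [by left; apply/val_inj|by right; apply/val_inj].
Qed.

Lemma ord3_uniq (i : 'I_3) : uniq [:: i; i + 1; i + 1 + 1].
Proof. by case: i => [[|[|[|//]]] ?]. Qed.

Lemma ord3_cycle (i : 'I_3) : i + 1 + 1 + 1 = i.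
Proof. by apply/val_inj; case: i => [[|[|[|//]]] ?]. Qed.

Lemma ord3_mem (i j k l : 'I_3) : uniq [:: i; j; k] -> l \in [:: i; j; k].
Proof.
move=> ijk; have [||_ ->] := uniq_min_size ijk (s2 := enum 'I_3).
- by move=> x _; rewrite mem_enum.
- by rewrite size_enum_ord.
- by rewrite mem_enum.
Qed.

Theorem theorem1 (R : realType) (F : fieldType) (n : nat)
    (K : {set {set 'I_n}}) (V : 'I_3 -> {set 'I_n})
    (hK : triangulated_surface R K)
    (hV : vertex_partition K V)
    (hH : forall i : 'I_3,
       rel_homology F (induced K (V i))
         (induced K (V i) :&: boundary_complex R K)%SET 1 = 0%VS) :
  exists s : {set 'I_n}, rainbow_triangle K V s.
Proof.
have [Ksub _ _] := hK; have [Vn0 Vd Vc] := hV.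
have disjV i j v : v \in V i -> v \in V j -> i = j.
  move=> vi vj; apply/eqP/negPn/negP => ij.
  by have := Vd i j ij => /finset.setP/(_ v); rewrite !inE vi vj.
have coverV v : [set v]%SET \in K -> exists i, v \in V i.
  move=> vK; have : v \in vertices K by rewrite inE.
  by rewrite -Vc => /finset.bigcupP[i _ vi]; exists i.
have VK i v : v \in V i -> [set v]%SET \in K.
  move=> vi; have : v \in vertices K by rewrite -Vc; apply/finset.bigcupP; exists i.
  by rewrite inE.
apply: contrapT => none.
have no_rainbow i j k a b c : uniq [:: i; j; k] ->
    a \in V i -> b \in V j -> c \in V k -> [set a; b; c]%SET \notin K.
  move=> ijk ai bj ck; apply/negP => abcK; apply: none; exists [set a; b; c]%SET.
  have [ij ik jk] := uniq3E ijk.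
  have other x l m : x \in V l -> l != m -> (x \in V m) = false.
    by move=> xl; apply: contraNF => xm; apply/eqP; exact: disjV xl xm.
  have neq x y l m : x \in V l -> y \in V m -> l != m -> x != y.
    by move=> xl ym lm; apply: contraTneq xl => ->; rewrite (other y m)// eq_sym.
  split=> //.
    by apply: card_set3; rewrite /= !inE negb_or (neq a b i j)// (neq a c i k)//
      (neq b c j k).
  move=> l; apply/eqP/cards1P; move: (ord3_mem l ijk).
  rewrite !inE => /or3P[]/eqP->; [exists a|exists b|exists c];
    apply/finset.setP => z; rewrite !inE.
  - have [->|_] := eqVneq z a; first by rewrite ai.
    have [->|_] := eqVneq z b; first by rewrite (other b j)// eq_sym.
    have [->|//] := eqVneq z c; by rewrite (other c k)// eq_sym.
  - have [->|_] := eqVneq z b; first by rewrite orbT bj.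
    have [->|_] := eqVneq z a; first by rewrite (other a i).
    have [->|//] := eqVneq z c; by rewrite (other c k)// eq_sym.
  - have [->|_] := eqVneq z c; first by rewrite orbT ck.
    have [->|_] := eqVneq z a; first by rewrite (other a i).
    have [->|//] := eqVneq z b; by rewrite (other b j).
have cof a b c c' d : uniq [:: a; b; c; c'] -> [set a; b; c]%SET \in K ->
    [set a; b; c']%SET \in K -> d \notin [set a; b]%SET -> [set a; b; d]%SET \in K ->
    d = c \/ d = c'.
  move=> u abcK abc'K; rewrite !inE negb_or => /andP[/negbTE da /negbTE db] dK.
  have [|||] := edge_cofaces hK u abcK abc'K dK; rewrite ?inE ?eqxx ?orbT//;
    move=> /fintype.subsetP/(_ d); rewrite !inE eqxx orbT da db /= => /(_ isT)/eqP;
    by [left|right].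
have colour i j : i != j -> exists Z : 'I_n -> bool,
  [/\ forall v u, v \in V i -> u \in V i -> [set v; u]%SET \in K -> Z v -> Z u,
      forall v u, v \in V i -> u \in V j -> [set v; u]%SET \in K -> Z v
    & forall v u k, v \in V i -> u \in V k -> uniq [:: i; j; k] ->
      [set v; u]%SET \in K -> ~~ Z v].
  move=> ij; apply: (colour_seen (F := F) (Bd := boundary_complex R K)) => //.
  - exact: edge_in_triangle hK.
  - exact: boundary_edge_vertex hK.
  - exact: interior_edge hK.
  - exact: link_connected hK.
have {colour}/choice[Z ZP] i : exists Zi : 'I_n -> bool,
  [/\ forall v u, v \in V i -> u \in V i -> [set v; u]%SET \in K -> Zi v -> Zi u,
      forall v u, v \in V i -> u \in V (i + 1) -> [set v; u]%SET \in K -> Zi v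
    & forall v u, v \in V i -> u \in V (i + 1 + 1) ->
      [set v; u]%SET \in K -> ~~ Zi v].
  have iu := ord3_uniq i; have [ij _ _] := uniq3E iu.
  have [Zi [Z1 Z2 Z3]] := colour _ _ ij; exists Zi; split=> //.
  by move=> v u vi uk; exact: Z3 vi uk iu.
(* [Z i v] excludes neighbours of colour [i + 1 + 1], and its negation those of colour [i + 1]. *)
pose missing i v : 'I_3 := if Z i v then i + 1 + 1 else i + 1.
have missing_edge i j v u : v \in V i -> u \in V j -> [set v; u]%SET \in K ->
    missing i v = missing j u.
  move=> vi uj vuK; have uvK : [set u; v]%SET \in K by rewrite finset.setUC.
  have [ij|/ord3_cases] := eqVneq i j.
    rewrite /missing -ij in uj *; have [Z1 _ _] := ZP i.
    by have -> : Z i v = Z i u by apply/idP/idP; [exact: Z1|exact: Z1].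
  (* Adjacent vertices of different colours see each other's colour, so both miss the third one. *)
  have [_ Zi Zi'] := ZP i; have [_ Zj Zj'] := ZP j.
  case=> ji; rewrite /missing.
    rewrite (Zi v u)//; last by rewrite -ji.
    by rewrite ifN; [rewrite ji|apply: Zj' uj _ uvK; rewrite ji ord3_cycle].
  rewrite ifN; last by apply: Zi' vi _ vuK; rewrite -ji.
  by rewrite (Zj u v)// ji ord3_cycle.
have /finset.set0Pn[v0 v00] := Vn0 0.
set m := missing 0 v0.
(* Connectedness will carry the missing colour [m] over to a vertex [v] of colour [m], although
   [missing m v] is [m + 1] or [m + 1 + 1]. *)
have /finset.set0Pn[v vm] := Vn0 m.
pose M : {set 'I_n} := [set w | [forall i, (w \in V i) ==> (missing i w == m)]]%SET.
have : v \in M.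
  apply: (skeleton_connected hK (VK _ _ v00) (VK _ _ vm)).
    move=> a b abK; rewrite !inE => /forallP aM; apply/forallP => j; apply/implyP => bj.
    have [|i ai] := coverV a; first by apply: Ksub abK _; rewrite finset.subsetUl.
    by rewrite -(missing_edge i j a b)//; have /implyP := aM i; exact.
  rewrite inE; apply/forallP => i; apply/implyP => v0i.
  by rewrite -(disjV 0 i v0).
rewrite inE => /forallP/(_ m); rewrite vm /= /missing.
have [m1 m2 _] := uniq3E (ord3_uniq m).
by case: ifP => _ /eqP/esym/eqP; apply/negP.
Qed.
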